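(* The Gerstenhaber bracket $[-,-]:HH^{-2}(A)\otimes HH^{-1}(A)\to HH^{-2}(A)$ is determined by the following relations. All brackets $[A^{-2},f]$ with $f$ a basis element of $HH^{-1}(A)$ are zero, except $[A^{-2},A^{-1}]=A^{-2}$. For $B^{-2}=B^{-2}(n_{2,p};m_{1,p})$: $[B^{-2},A^{-1}]=-(\sum_{i=2}^{p}n_i+p-2)B^{-2}(n_{2,p};m_{1,p})$; $[B^{-2},B^{-1}(m)]=-\sum_{i=2}^{p}n_iB^{-2}(n_{2,i-1},n_i+m,n_{i+1,p};m_{1,p})$; $[B^{-2},C^{-1}(m)]=-\sum_{i=1}^{p}\sum_{j=1}^{m_i-1}B^{-2}(n_{2,i},m-1,n_{i+1,p};m_{1,i-1},j,m_i-j,m_{i+1,p})$; $[B^{-2},D^{-1}(m,j)]=0$; $[B^{-2},E^{-1}(r_{0,q+1};s_{1,q})]=0$; $[B^{-2},F^{-1}(r_{1,q+1};s_{1,q})]=-\sum_{i=2}^{p}\sum_{j=0}^{n_i-1}B^{-2}(n_{2,i-1},r_1+j,r_{2,q},r_{q+1}+n_i-j-2,n_{i+1,p};m_{1,i-1},s_{1,q},m_{i,p})$; $[B^{-2},G^{-1}(r_{1,q+1};s_{1,q})]=\sum_{i=1}^{p}\sum_{j=1}^{m_i-1}B^{-2}(n_{2,i},r_{1,q},r_{q+1}-1,n_{i+1,p};m_{1,i-1},j,s_{1,q},m_i-j,m_{i+1,p})$; $[B^{-2},H^{-1}(\,;s_1)]=-\sum_{i=1}^{p}m_iB^{-2}(n_{2,p};m_{1,i-1},s_1+m_i-1,m_{i+1,p})$;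 for $q\ge2$, $[B^{-2},H^{-1}(r_{2,q};s_{1,q})]=-\sum_{i=1}^{p}\sum_{j=0}^{m_i-1}B^{-2}(n_{2,i},r_{2,q},n_{i+1,p};m_{1,i-1},j+s_1,s_{2,q-1},s_q+m_i-j-1,m_{i+1,p})$.
   Context: $\mathbf{k}$ is a field of characteristic $0$, $A=\mathbf{k}\langle x,y,z\rangle/(x^2+yx,\,xz,\,zy)$, $A^e=A\otimes A^{\mathrm{op}}$, $HH^{-n}(A)=\mathrm{Ext}^n_{A^e}(A,A)$. $n_{a,b}$ denotes the sequence $n_a,\dots,n_b$ (empty if $b<a$); $z^{m_1}\cdots z^{m_p}$ is shorthand for $z^{m_1}xy^{n_2}z^{m_2}\cdots xy^{n_p}z^{m_p}$ (equal to $z^{m_1}$ for $p=1$). All parameters $n,m,p,q,n_i,m_i,r_i,s_i$ are positive integers. Index convention: a basis symbol with an index outside its range of definition (e.g. a zero entry) is $0$; sums with upper limit smaller than the lower limit are $0$. $A$ is Koszul; $HH^{-n}(A)$ is the $n$-th cohomology of $\mathrm{Hom}(V_\bullet,A)$ coming from the two-sided Koszul resolution, with $V_1=\mathbf k\{x,y,z\}$, $V_2=\mathbf k\{(x+y)x,xz,zy\}\subset V_1\otimes V_1$. It is identified with the cohomology of the reduced Hochschild cochain complex $\mathrm{Hom}(\overline A^{\otimes n},A)$, $\overline A=A/\mathbf k1$, by restricting Hochschild cochains along $V_n\subset V_1^{\otimes n}\to\overline A^{\otimes n}$. For Hochschild cocycles $g\in\mathrm{Hom}(\overline A^{\otimes2},A)$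 and $f\in\mathrm{Hom}(\overline A,A)$ the Gerstenhaber bracket is $[g,f](a_1\otimes a_2)=g(f(a_1)\otimes a_2)+g(a_1\otimes f(a_2))-f(g(a_1\otimes a_2))$. Basis of $HH^{-2}(A)$ (classes of Koszul cocycles): $A^{-2}$: $(x+y)x\mapsto x,\ xz\mapsto0,\ zy\mapsto0$; $B^{-2}(n_{2,p};m_{1,p})$: $(x+y)x\mapsto z^{m_1}\cdots z^{m_p}x,\ xz\mapsto 0,\ zy\mapsto 0$. Basis of $HH^{-1}(A)$ (images of $(x,y,z)$): $A^{-1}$: $(x,y,0)$; $B^{-1}(n)$: $(y^nx,\,y^{n+1},\,0)$; $C^{-1}(n)$: $(y^nx,\,-xy^n,\,zxy^{n-1})$; $D^{-1}(n,i)$, $1\le i\le n-1$: $(y^nx,\,-y^ixy^{n-i},\,0)$; $E^{-1}(n_{0,p+1};m_{1,p})$: $(0,\,y^{n_0}xy^{n_1}z^{m_1}\cdots z^{m_p}xy^{n_{p+1}-1},\,0)$; $F^{-1}(n_{1,p+1};m_{1,p})$: $(0,\,y^{n_1}z^{m_1}\cdots z^{m_p}xy^{n_{p+1}-1},\,0)$; $G^{-1}(n_{1,p+1};m_{1,p})$: $(0,\,xy^{n_1}z^{m_1}\cdots z^{m_p}xy^{n_{p+1}},\,-zxy^{n_1}z^{m_1}\cdots z^{m_p}xy^{n_{p+1}-1})$; $H^{-1}(n_{2,p};m_{1,p})$: $(0,\,0,\,z^{m_1}\cdots z^{m_p})$. *)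

(* Defs.v *)
From HB Require Import structures.
From mathcomp Require Import all_boot all_algebra.
From mathcomp Require Import generic_quotient ring_quotient monalg.
From mathcomp.classical Require Import boolp.

Set Implicit Arguments.
Unset Strict Implicit.
Unset Printing Implicit Defensive.

Import GRing.Theory.
Local Open Scope quotient_scope.
Local Open Scope ring_scope.

Section Algebra.
Variable k : fieldType.

Local Notation free_alg := {malg k[{fmonom 'I_3}]}.

Definition X : free_alg := << fmu (@Ordinal 3 0 isT) >>.
Definition Y : free_alg := << fmu (@Ordinal 3 1 isT) >>.
Definition Z : free_alg := << fmu (@Ordinal 3 2 isT) >>.

(* The two-sided ideal (x^2 + yx, xz, zy) of k<x,y,z>. *)
Inductive rel_ideal : free_alg -> Prop :=
| rel_yx : rel_ideal (X ^+ 2 + Y * X)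
| rel_xz : rel_ideal (X * Z)
| rel_zy : rel_ideal (Z * Y)
| rel_0 : rel_ideal 0
| rel_add p q : rel_ideal p -> rel_ideal q -> rel_ideal (p + q)
| rel_mull p q : rel_ideal q -> rel_ideal (p * q)
| rel_mulr p q : rel_ideal p -> rel_ideal (p * q).

Definition rel_pred : {pred free_alg} := fun p => `[< rel_ideal p >].

Lemma rel_predP p : reflect (rel_ideal p) (p \in rel_pred).
Proof. exact: asboolP. Qed.

Lemma rel_pred_zmod_closed : zmod_closed rel_pred.
Proof.
split=> [|p q /rel_predP Ip /rel_predP Iq]; apply/rel_predP; first exact: rel_0.
by rewrite -mulN1r; apply/rel_add/rel_mull.
Qed.

HB.instance Definition _ :=
  GRing.isZmodClosed.Build free_alg rel_pred rel_pred_zmod_closed.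

Definition alg : Type := Quotient.quot rel_pred.

HB.instance Definition _ := GRing.Zmodule.on alg.
HB.instance Definition _ : EqQuotient free_alg (Quotient.equiv rel_pred) alg :=
  EqQuotient.on alg.

Definition to_alg (p : free_alg) : alg := \pi_alg p.

Lemma to_alg_eq p q : to_alg p = to_alg q <-> rel_ideal (p - q).
Proof.
rewrite /to_alg; split=> [/eqP|] E.
  by apply/rel_predP; rewrite Quotient.idealrBE.
by apply/eqP; rewrite -Quotient.idealrBE; apply/rel_predP.
Qed.

Lemma to_algD p q : to_alg (p + q) = to_alg p + to_alg q.
Proof. by rewrite /to_alg piE. Qed.

Lemma to_alg_repr a : to_alg (repr a) = a.
Proof. exact: reprK. Qed.

Lemma rel_repr p : rel_ideal (repr (to_alg p) - p).
Proof. by apply/to_alg_eq; rewrite to_alg_repr. Qed.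

Definition alg_one : alg := to_alg 1.
Definition alg_mul (a b : alg) : alg := to_alg (repr a * repr b).
Definition alg_scale (c : k) (a : alg) : alg := to_alg (c *: repr a).

Lemma alg_mulE p q : alg_mul (to_alg p) (to_alg q) = to_alg (p * q).
Proof.
apply/to_alg_eq; rewrite -[_ * _](addrNK (p * repr (to_alg q))).
rewrite -mulrBl -addrA -mulrBr.
by apply/rel_add; [apply/rel_mulr/rel_repr|apply/rel_mull/rel_repr].
Qed.

Lemma alg_scaleE c p : alg_scale c (to_alg p) = to_alg (c *: p).
Proof.
apply/to_alg_eq; rewrite -scalerBr -[_ - _]mul1r scalerAl.
exact/rel_mull/rel_repr.
Qed.

(* Every element of the ideal has zero constant term. *)
Lemma rel_ideal_aug p : rel_ideal p -> p@_mone = 0.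
Proof.
have augM (q r : free_alg) : (q * r)@_mone = q@_mone * r@_mone by exact: rmorphM.
have aug_gen i : (<< fmu i >> : free_alg)@_mone = 0.
  by rewrite mcoeffU -fdeg_eq0 fdegU.
elim=> {p} [|||||p q _ IHq|p q _ IHp].
- by rewrite mcoeffD expr2 !augM !aug_gen !mul0r addr0.
- by rewrite augM aug_gen mul0r.
- by rewrite augM aug_gen mul0r.
- exact: mcoeff0.
- by move=> p q _ IHp _ IHq; rewrite mcoeffD IHp IHq addr0.
- by rewrite augM IHq mulr0.
- by rewrite augM IHp mul0r.
Qed.

Lemma alg_mulA : associative alg_mul.
Proof.
move=> a b c; rewrite -(to_alg_repr a) -(to_alg_repr b) -(to_alg_repr c).
by rewrite !alg_mulE mulrA.
Qed.

Lemma alg_mul1 : left_id alg_one alg_mul.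
Proof. by move=> a; rewrite -(to_alg_repr a) alg_mulE mul1r. Qed.

Lemma alg_mulr1 : right_id alg_one alg_mul.
Proof. by move=> a; rewrite -(to_alg_repr a) alg_mulE mulr1. Qed.

Lemma alg_mulDl : left_distributive alg_mul +%R.
Proof.
move=> a b c; rewrite -(to_alg_repr a) -(to_alg_repr b) -(to_alg_repr c).
by rewrite -to_algD !alg_mulE -to_algD mulrDl.
Qed.

Lemma alg_mulDr : right_distributive alg_mul +%R.
Proof.
move=> a b c; rewrite -(to_alg_repr a) -(to_alg_repr b) -(to_alg_repr c).
by rewrite -to_algD !alg_mulE -to_algD mulrDr.
Qed.

Lemma alg_one_neq0 : alg_one != 0.
Proof.
rewrite -[X in _ != X]addr0; apply/eqP.
have -> : 0 + 0 = to_alg 0 by rewrite addr0 /to_alg piE.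
move/to_alg_eq/rel_ideal_aug/eqP.
by rewrite subr0 rmorph1 oner_eq0.
Qed.

HB.instance Definition _ := GRing.Zmodule_isNzRing.Build alg
  alg_mulA alg_mul1 alg_mulr1 alg_mulDl alg_mulDr alg_one_neq0.

Lemma alg_scaleA c d a : alg_scale c (alg_scale d a) = alg_scale (c * d) a.
Proof. by rewrite -(to_alg_repr a) !alg_scaleE scalerA. Qed.

Lemma alg_scale1 : left_id 1 alg_scale.
Proof. by move=> a; rewrite -(to_alg_repr a) alg_scaleE scale1r. Qed.

Lemma alg_scaleDr : right_distributive alg_scale +%R.
Proof.
move=> c a b; rewrite -(to_alg_repr a) -(to_alg_repr b).
by rewrite -to_algD !alg_scaleE -to_algD scalerDr.
Qed.

Lemma alg_scaleDl a : {morph alg_scale^~ a : c d / c + d}.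
Proof. by move=> c d; rewrite -(to_alg_repr a) !alg_scaleE -to_algD scalerDl. Qed.

HB.instance Definition _ := GRing.Zmodule_isLmodule.Build k alg
  alg_scaleA alg_scale1 alg_scaleDr alg_scaleDl.

Lemma alg_scaleAl (c : k) (a b : alg) : c *: (a * b) = c *: a * b.
Proof.
rewrite -(to_alg_repr a) -(to_alg_repr b).
rewrite /GRing.mul /GRing.scale /= !(alg_mulE, alg_scaleE).
by rewrite scalerAl.
Qed.

HB.instance Definition _ := GRing.Lmodule_isLalgebra.Build k alg alg_scaleAl.

Lemma alg_scaleAr (c : k) (a b : alg) : c *: (a * b) = a * (c *: b).
Proof.
rewrite -(to_alg_repr a) -(to_alg_repr b).
rewrite /GRing.mul /GRing.scale /= !(alg_mulE, alg_scaleE).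
congr to_alg; rewrite -[c *: repr b]mul_malgC -[LHS]mul_malgC !mulrA.
congr (_ * _); apply/malgP=> m.
rewrite mul_malgC mcoeffZ mulrC -[RHS]/((repr a * c%:MP)@_m).
by rewrite [repr a]monalgE mulr_suml !raddf_sum mulr_suml; apply: eq_bigr => w _;
   rewrite /= mcoeffU malgM_def fgmulUU mulm1 mcoeffU mulrnAl.
Qed.

HB.instance Definition _ := GRing.Lalgebra_isAlgebra.Build k alg alg_scaleAr.

Definition x : alg := to_alg X.
Definition y : alg := to_alg Y.
Definition z : alg := to_alg Z.

(* A cochain in Hom(V_1, A) is given by its values on x, y, z, a cochain in
   Hom(V_2, A) by its values on (x+y)x, xz, zy. *)
Definition cochain1 : Type := (alg * alg * alg)%type.
Definition cochain2 : Type := (alg * alg * alg)%type.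

(* The Koszul differentials A -> Hom(V_1, A) -> Hom(V_2, A), up to sign. *)
Definition koszul_d0 (a : alg) : cochain1 :=
  (x * a - a * x, y * a - a * y, z * a - a * z).

Definition koszul_d1 (phi : cochain1) : cochain2 :=
  let: (fx, fy, fz) := phi in
  ((fx + fy) * x + (x + y) * fx, fx * z + x * fz, fz * y + z * fy).

(* The reduced Hochschild complex Hom(Abar^{(x)n}, A) in degrees 1 and 2:
   (multi)linear maps on A that vanish as soon as one argument is 1. *)
Definition reduced1 (f : alg -> alg) : Prop := linear f /\ f 1 = 0.

Definition reduced2 (g : alg -> alg -> alg) : Prop :=
  [/\ forall a, linear (g a), forall b, linear (g^~ b),
      forall b, g 1 b = 0 & forall a, g a 1 = 0].

Definition cocycle1 (f : alg -> alg) : Prop :=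
  forall a b, a * f b - f (a * b) + f a * b = 0.

Definition cocycle2 (g : alg -> alg -> alg) : Prop :=
  forall a b c, a * g b c - g (a * b) c + g a (b * c) - g a b * c = 0.

(* Restriction of Hochschild cochains along V_n -> Abar^{(x)n}. *)
Definition restrict1 (f : alg -> alg) : cochain1 := (f x, f y, f z).

Definition restrict2 (g : alg -> alg -> alg) : cochain2 :=
  (g (x + y) x, g x z, g z y).

(* [represents1 f phi] and [represents2 g u] say that the Hochschild class of
   the cocycle f (resp. g) in HH^{-1}(A) (resp. HH^{-2}(A)) is identified with
   the class of the Koszul cochain phi (resp. u). *)
Definition represents1 (f : alg -> alg) (phi : cochain1) : Prop :=
  [/\ reduced1 f, cocycle1 f & exists a, restrict1 f = phi + koszul_d0 a].

Definition represents2 (g : alg -> alg -> alg) (u : cochain2) : Prop :=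
  [/\ reduced2 g, cocycle2 g & exists phi, restrict2 g = u + koszul_d1 phi].

Definition gerstenhaber (g : alg -> alg -> alg) (f : alg -> alg) :
    alg -> alg -> alg :=
  fun a b => g (f a) b + g a (f b) - f (g a b).

(* The relation [u, phi] = w between the classes of the Koszul cochains u, phi
   and w. Hochschild cocycles representing u and phi are required to exist, and
   the bracket of any such cocycles must represent w. *)
Definition bracket_eq (u : cochain2) (phi : cochain1) (w : cochain2) : Prop :=
  [/\ exists g, represents2 g u, exists f, represents1 f phi &
      forall g f, represents2 g u -> represents1 f phi ->
        represents2 (gerstenhaber g f) w].

(* The sequence n_a, ..., n_b. *)
Definition seg (n : nat -> nat) (a b : nat) : seq nat :=
  [seq n i | i <- index_iota a b.+1].

(* For ns = n_2, ..., n_p and ms = m_1, ..., m_p, the element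
   z^{m_1} x y^{n_2} z^{m_2} ... x y^{n_p} z^{m_p}. *)
Definition zword (ns ms : seq nat) : alg :=
  z ^+ head 0%N ms *
  \prod_(nm <- zip ns (behead ms)) (x * y ^+ nm.1 * z ^+ nm.2).

Definition A2 : cochain2 := (x, 0, 0).

(* A zero entry is out of range, and the symbol is then 0. *)
Definition B2 (ns ms : seq nat) : cochain2 :=
  if all (ltn 0) ns && all (ltn 0) ms then (zword ns ms * x, 0, 0) else 0.

Definition A1 : cochain1 := (x, y, 0).

Definition B1 (n : nat) : cochain1 := (y ^+ n * x, y ^+ n.+1, 0).

Definition C1 (n : nat) : cochain1 :=
  (y ^+ n * x, - (x * y ^+ n), z * x * y ^+ n.-1).

Definition D1 (n i : nat) : cochain1 :=
  (y ^+ n * x, - (y ^+ i * x * y ^+ (n - i)), 0).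

Section Families.
Variables (p : nat) (n m : nat -> nat).

Let w : alg := zword (seg n 2 p) (seg m 1 p).

Definition E1 : cochain1 :=
  (0, y ^+ n 0%N * x * y ^+ n 1%N * w * x * y ^+ (n p.+1).-1, 0).

Definition F1 : cochain1 :=
  (0, y ^+ n 1%N * w * x * y ^+ (n p.+1).-1, 0).

Definition G1 : cochain1 :=
  (0, x * y ^+ n 1%N * w * x * y ^+ n p.+1,
      - (z * x * y ^+ n 1%N * w * x * y ^+ (n p.+1).-1)).

Definition H1 : cochain1 := (0, 0, w).

End Families.

End Algebra.

Arguments A2 {k}.
Arguments B2 {k}.
Arguments A1 {k}.
Arguments B1 {k}.
Arguments C1 {k}.
Arguments D1 {k}.
Arguments E1 {k}.
Arguments F1 {k}.
Arguments G1 {k}.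
Arguments H1 {k}.

Definition positive (n : nat -> nat) : Prop := forall i, (0 < n i)%N.

(* Main.v *)
(* Write A = F / I with F the free algebra, pi : F -> A, and I generated by
   r1 = (x + y) x, xz, zy. The pullback to F of a Hochschild 2-cocycle g is a
   coboundary: there is a linear G : F -> A with
     G (p q) = pi p * G q + G p * pi q + g (pi p) (pi q),
   its restriction to I is a bimodule map, and (G r1, G xz, G zy) is a Koszul
   cocycle representing g. If a derivation f of A lifts to a derivation D of F,
   then G D - f G plays the same role for [g, f], so that the bracket is the class
   of r |-> G (D r) - f (G r); it can be computed from the values of G on r1, xz
   and zy alone, and correcting by explicit coboundaries leaves minus the
   derivative of the word defining B^{-2}. Conversely a cocycle with values
   (v, 0, 0), where v z = 0, is built from normal forms of words for the rewriting
   system yx -> -xx, xz -> 0, zy -> 0, zxx -> 0. *)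

(* The bracket must be computed for every pair of representatives, so no explicit formula for [g] or
   [f] is available. The free algebra makes this harmless: a derivation is fixed by its values on
   three letters, a bimodule map on the ideal by its values on three relations. A representative [f]
   agrees with its Koszul cochain only up to an inner derivation; the inner part of its lift
   contributes commutators with one fixed element, and these are absorbed by replacing [f] with its
   inner correction. Explicit cochains occur only to show that (v, 0, 0) has a representative at
   all. The condition v z = 0 comes from the overlap (x + y) x z, which is both r1 z and (x + y)
   (xz). In the final sums the letter z decides which terms survive: xz = 0, zy = 0 and z x y^m x =
   0 kill insertions next to a wrong letter, which accounts for the summation ranges and for symbols
   with a zero entry being 0. *)
From HB Require Import structures.
Require Import Defs.
From mathcomp Require Import all_boot all_algebra finmap zify.
From mathcomp Require Import monalg.
From mathcomp.classical Require Import boolp.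

Set Implicit Arguments.
Unset Strict Implicit.
Unset Printing Implicit Defensive.

Import GRing.Theory.
Local Open Scope ring_scope.

(** * Linear maps and induction on the free algebra *)

Section MonalgLinear.
Variables (K : choiceType) (R : comNzRingType) (W : lmodType R).

Lemma malg_linear_ex (h : K -> W) :
  exists2 E : {malg R[K]} -> W, linear E & forall m, E << m >> = h m.
Proof.
pose E (p : {malg R[K]}) : W := \sum_(m <- msupp p) p@_m *: h m.
(* Coefficients outside the support are 0, so every finite set containing it gives the same sum;
   [p], [q] and [c *: p + q] can then be compared on one set [d]. *)
have Ew (d : {fset K}) p : (msupp p `<=` d)%fset ->
    E p = \sum_(m <- d) p@_m *: h m.
  move=> le; rewrite /E; apply: big_fset_incl => // m _ /mcoeff_outdom ->.
  by rewrite scale0r.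
exists E => [c p q|m]; last first.
  by rewrite (Ew [fset m]%fset) ?msuppU_le // big_seq_fset1 mcoeffUU scale1r.
pose d := (msupp (c *: p + q) `|` (msupp p `|` msupp q))%fset.
have dp : (msupp p `<=` d)%fset by rewrite /d fsubsetU // fsubsetUl orbT.
have dq : (msupp q `<=` d)%fset by rewrite /d fsubsetU // fsubsetUr orbT.
rewrite (Ew d) ?fsubsetUl // (Ew d p) // (Ew d q) // scaler_sumr -big_split /=.
by apply: eq_bigr => m _; rewrite mcoeffD mcoeffZ scalerDl scalerA.
Qed.

Lemma malg_basis_ind (P : {malg R[K]} -> Prop) :
  (forall c p q, P p -> P q -> P (c *: p + q)) ->
  P 0 -> (forall m, P << m >>) -> forall p, P p.
Proof.
move=> PD P0 PU p; rewrite (monalgE p).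
elim: (enum_fset _) => [|m s IH]; rewrite ?big_nil // big_cons.
suff -> : << p@_m *g m >> = p@_m *: << m >> :> {malg R[K]} by apply: PD.
by apply/malgP=> i; rewrite mcoeffZ !mcoeffU mulr_natr.
Qed.

End MonalgLinear.

Section FreeAlgebra.
Variables (I : choiceType) (R : comNzRingType).
Local Notation F := {malg R[{fmonom I}]}.
Local Notation "'G_ i" := (<< fmu i >> : F) (at level 2).

Lemma monomM a b (m n : {fmonom I}) :
  << a *g m >> * << b *g n >> = << a * b *g mmul m n >> :> F.
Proof. by rewrite malgM_def fgmulUU. Qed.

Lemma monomZ c b (n : {fmonom I}) : c *: << b *g n >> = << c * b *g n >> :> F.
Proof. by apply/malgP=> l; rewrite mcoeffZ !mcoeffU mulrnAr. Qed.

Lemma free_scaleAr c (p q : F) : c *: (p * q) = p * (c *: q).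
Proof.
rewrite [p]monalgE [q]monalgE !mulr_suml !scaler_sumr.
apply: eq_bigr => i _; rewrite /= !mulr_sumr scaler_sumr.
by apply: eq_bigr => j _; rewrite monomZ !monomM monomZ mulrCA.
Qed.

Lemma free_cons i s : << FMonom (i :: s) >> = 'G_ i * << FMonom s >> :> F.
Proof.
by rewrite monomM mulr1; congr (<< _ >>); apply/val_inj; rewrite /= fmM fmU.
Qed.

Lemma free_nil : << FMonom [::] >> = 1 :> F.
Proof. by congr (<< _ >>); apply/val_inj; rewrite /= fm1. Qed.

Lemma free_ind (P : F -> Prop) :
  (forall c p q, P p -> P q -> P (c *: p + q)) -> P 1 ->
  (forall i p, P p -> P ('G_ i * p)) -> forall p, P p.
Proof.
move=> PD P1 PX; apply: malg_basis_ind => //.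
  by rewrite -(subrr 1) addrC -scaleN1r; apply: PD.
by case; elim=> [|i s IH]; rewrite ?free_nil // free_cons; apply: PX.
Qed.

(** The free algebra is the initial pointed module with one endomorphism per letter: a word goes to
    the composite of its [L i] applied to [w], a right fold. *)
Lemma free_rec (W : lmodType R) (w : W) (L : I -> W -> W) :
  (forall i, linear (L i)) ->
  exists E : F -> W, [/\ linear E, E 1 = w & forall i p, E ('G_ i * p) = L i (E p)].
Proof.
move=> linL.
have [E linE EU] := malg_linear_ex (fun m : {fmonom I} => foldr L w m).
exists E; split=> [//||i]; first by rewrite -free_nil EU.
have EZ0 : E 0 = 0.
  have := linE (-1) 0 0; rewrite scaler0 addr0 scaleN1r => {1}->.
  by rewrite addNr.
have L0 : L i 0 = 0.
  have := linL i (-1) 0 0; rewrite scaler0 addr0 scaleN1r => {1}->.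
  by rewrite addNr.
apply: malg_basis_ind => [c p q Ep Eq||].
- by rewrite mulrDr -free_scaleAr !linE linL Ep Eq.
- by rewrite mulr0 EZ0 L0.
- by case=> s; rewrite -free_cons !EU.
Qed.

End FreeAlgebra.

(** * Cancellation of opposite terms in sums *)

Lemma abel_trans (V : zmodType) (t r s : V) : t + r = s -> s = 0 -> t + r = 0.
Proof. by move=> ->. Qed.

Lemma abel_skip (V : zmodType) (t a r s : V) : t + r = s -> t + (a + r) = a + s.
Proof. by move=> <-; rewrite addrCA. Qed.

Lemma abel_last (V : zmodType) (t a : V) : t + (a - t) = a.
Proof. by rewrite addrC subrK. Qed.

Lemma abel_lastN (V : zmodType) (t a : V) : - t + (a + t) = a.
Proof. by rewrite addrC addrK. Qed.

(** The leading summand travels to the right through [abel_skip] until it meets its opposite; the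
    right-hand side is an existential variable that becomes the sum left over. *)
Ltac abel_find := first
  [ exact: addNKr | exact: addKr | exact: abel_last | exact: abel_lastN
  | apply: abel_skip; abel_find ].
Ltac abel_step := first
  [ exact: addrN | exact: addNr | apply: abel_trans; [abel_find | ] ].
(* Proves equalities of sums of signed atoms by cancelling opposite terms. *)
Ltac abel := apply/eqP; rewrite -subr_eq0; apply/eqP;
  rewrite ?(scalerN, opprD, opprK, oppr0, addr0, add0r) -?addrA;
  repeat abel_step; try reflexivity.
Ltac ncring :=
  rewrite ?(opprD, opprK, mulrDl, mulrDr, mulrN, mulNr, mul0r, mulr0, mul1r, mulr1, mulrA); abel.

Lemma linear_bundle (R : nzRingType) (U V : lmodType R) (f : U -> V) :
  linear f -> exists f' : {linear U -> V}, f' =1 f.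
Proof.
move=> lf; pose f' : {linear U -> V} := HB.pack f (GRing.isLinear.Build R U V *:%R f lf).
by exists f'.
Qed.

(* The cochains of Defs over an arbitrary algebra with three marked elements;
   they are convertible to the original ones for the algebra [alg k]. *)
Section Cochains.
Variables (k : fieldType) (A : algType k) (x y z : A).

Definition kd0 (a : A) : A * A * A := (x * a - a * x, y * a - a * y, z * a - a * z).

Definition kd1 (phi : A * A * A) : A * A * A :=
  let: (fx, fy, fz) := phi in
  ((fx + fy) * x + (x + y) * fx, fx * z + x * fz, fz * y + z * fy).

Definition hh1_class (f : A -> A) (phi : A * A * A) : Prop :=
  [/\ linear f /\ f 1 = 0,
      forall a b, a * f b - f (a * b) + f a * b = 0 &
      exists a, (f x, f y, f z) = phi + kd0 a].

Definition hh2_class (g : A -> A -> A) (u : A * A * A) : Prop :=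
  [/\ [/\ forall a, linear (g a), forall b, linear (g^~ b),
          forall b, g 1 b = 0 & forall a, g a 1 = 0],
      forall a b c, a * g b c - g (a * b) c + g a (b * c) - g a b * c = 0 &
      exists phi, (g (x + y) x, g x z, g z y) = u + kd1 phi].

Definition bracket (g : A -> A -> A) (f : A -> A) : A -> A -> A :=
  fun a b => g (f a) b + g a (f b) - f (g a b).

Definition hh_bracket (u phi w : A * A * A) : Prop :=
  [/\ exists g, hh2_class g u, exists f, hh1_class f phi &
      forall g f, hh2_class g u -> hh1_class f phi -> hh2_class (bracket g f) w].

Lemma kd1D phi psi : kd1 (phi + psi) = kd1 phi + kd1 psi.
Proof.
case: phi psi => [[a b] c] [[a' b'] c']; congr (_, _, _) => /=.
all: by ncring.
Qed.

End Cochains.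

(** * Index segments and the words z^{m_1} x y^{n_2} ... z^{m_p} *)

Lemma seg_nil n a b : (b < a)%N -> seg n a b = [::].
Proof. by move=> ba; rewrite /seg /index_iota (_ : b.+1 - a = 0)%N //; lia. Qed.

Lemma seg_rcons n a b : (a <= b.+1)%N -> seg n a b.+1 = rcons (seg n a b) (n b.+1).
Proof.
move=> ab; rewrite /seg /index_iota subSn // -addn1 iotaD map_cat cats1 /=.
by congr (rcons _ (n _)); lia.
Qed.

Lemma seg_cons n a b : (a <= b)%N -> seg n a b = n a :: seg n a.+1 b.
Proof. by move=> ab; rewrite /seg /index_iota subSn //= subSS. Qed.

Lemma size_seg n a b : size (seg n a b) = (b.+1 - a)%N.
Proof. by rewrite size_map size_iota. Qed.

Lemma seg_cat n a b c : (a <= b.+1)%N -> (b <= c)%N ->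
  seg n a c = seg n a b ++ seg n b.+1 c.
Proof.
move=> ab bc; rewrite /seg /index_iota -map_cat; congr map.
have -> : (c.+1 - a = (b.+1 - a) + (c.+1 - b.+1))%N by lia.
by rewrite iotaD; congr (_ ++ iota _ _); lia.
Qed.

Lemma all_seg n a b : (forall i, (0 < n i)%N) -> all (ltn 0) (seg n a b).
Proof. by move=> np; apply/allP => _ /mapP [i _ ->]; exact: np. Qed.

Section Words.
Variables (R : nzRingType) (x y z : R).

Definition xyzword (ns ms : seq nat) : R :=
  z ^+ head 0%N ms *
  \prod_(nm <- zip ns (behead ms)) (x * y ^+ nm.1 * z ^+ nm.2).

(* Locked, so that associativity does not rewrite inside words. *)
Definition gword (ns ms : seq nat) : R := locked (xyzword ns ms).

Lemma gwordE ns ms : gword ns ms = xyzword ns ms.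
Proof. by rewrite /gword -lock. Qed.

Lemma gword1 m : gword [::] [:: m] = z ^+ m.
Proof. by rewrite gwordE /xyzword big_nil mulr1. Qed.

Lemma gword_cons n ns m ms : (0 < size ms)%N ->
  gword (n :: ns) (m :: ms) = z ^+ m * (x * y ^+ n) * gword ns ms.
Proof. by case: ms => // m' ms _; rewrite !gwordE /xyzword /= big_cons /= !mulrA. Qed.

(** The equal lengths of [ns1] and [ms1] make the first word complete once [a] is appended: [zip]
    truncates nothing, and the z-power [a] meets the z-power [b]. *)
Lemma gword_merge ns1 ms1 a b ns2 ms2 : size ns1 = size ms1 ->
  gword ns1 (rcons ms1 a) * gword ns2 (b :: ms2)
    = gword (ns1 ++ ns2) (ms1 ++ (a + b)%N :: ms2).
Proof.
elim: ns1 ms1 => [|n ns1 IH] [|m ms1] //= => [_|[sz]].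
  by rewrite gword1 !gwordE /xyzword /= exprD mulrA.
by rewrite !gword_cons ?size_cat ?size_rcons ?addnS // -IH // !mulrA.
Qed.

Lemma gword_join ns1 ms1 a n b ns2 ms2 : size ns1 = size ms1 ->
  gword ns1 (rcons ms1 a) * (x * y ^+ n) * gword ns2 (b :: ms2)
    = gword (ns1 ++ n :: ns2) (ms1 ++ a :: b :: ms2).
Proof.
by move=> sz; rewrite -[a in RHS]addn0 -gword_merge // gword_cons // expr0 mul1r !mulrA.
Qed.

Lemma gword_cat ns1 ms1 n ns2 ms2 : size ms1 = (size ns1).+1 -> (0 < size ms2)%N ->
  gword ns1 ms1 * (x * y ^+ n) * gword ns2 ms2 = gword (ns1 ++ n :: ns2) (ms1 ++ ms2).
Proof.
case/lastP: ms1 => // ms1 a; case: ms2 => // b ms2; rewrite size_rcons => -[sz] _.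
by rewrite gword_join // -cats1 -catA.
Qed.

Lemma gword_expl a b ns ms : z ^+ a * gword ns (b :: ms) = gword ns ((a + b)%N :: ms).
Proof. by rewrite !gwordE /xyzword /= exprD mulrA. Qed.

Lemma gword_expr ns ms a b : size ns = size ms ->
  gword ns (rcons ms a) * z ^+ b = gword ns (rcons ms (a + b)%N).
Proof. by move=> sz; rewrite -gword1 gword_merge // cats0 cats1. Qed.

Lemma gword_head ns ms : (0 < size ms)%N -> all (ltn 0) ms ->
  exists t, gword ns ms = z * t.
Proof.
case: ms => //= m ms _ /andP [m0 _]; exists (gword ns (m.-1 :: ms)).
by rewrite -[X in X * _](expr1 z) gword_expl add1n prednK.
Qed.

Lemma gword_last ns ms : size ms = (size ns).+1 -> all (ltn 0) ms ->
  exists t, gword ns ms = t * z.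
Proof.
case/lastP: ms => // ms m; rewrite size_rcons all_rcons => -[sz] /andP [m0 _].
exists (gword ns (rcons ms m.-1)).
by rewrite -[z in RHS]expr1 gword_expr // addn1 prednK.
Qed.

(* A zero exponent in front exposes a factor [x]. *)
Lemma gword0_x ns ms : size ns = size ms -> exists t, gword ns (0%N :: ms) * x = x * t.
Proof.
case: ns ms => [|n ns] [|m ms] //= _.
  by exists 1; rewrite gword1 expr0 mul1r mulr1.
by exists (y ^+ n * gword ns (m :: ms) * x); rewrite gword_cons // expr0 mul1r !mulrA.
Qed.

Variable f : R -> R.
Hypothesis fM : forall a b, f (a * b) = a * f b + f a * b.

Lemma derivation_expr t n :
  f (t ^+ n) = \sum_(0 <= j < n) t ^+ j * f t * t ^+ (n - j.+1).
Proof.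
elim: n => [|n IH]; last first.
  rewrite exprSr fM IH big_nat_recr //= subnn mulr1 addrC; congr (_ + _).
  rewrite mulr_suml; apply: eq_big_nat => j /andP [_ jn].
  by rewrite -mulrA -exprSr -subSn.
(* Leibniz at 1 * 1 forces [f 1 = 0]. *)
by rewrite big_geq // expr0; apply: (addrI (f 1)); rewrite addr0 -{3}[1]mulr1 fM mul1r mulr1.
Qed.

(** Leibniz over the alternating blocks z^{m_i} and x y^{n_i}. The exponents 0 next to
    [f (z ^+ m i)] pad both halves to complete words, ready to absorb powers of z when this factor
    is expanded. *)
Lemma gword_derivation (n m : nat -> nat) p : (0 < p)%N ->
  f (gword (seg n 2 p) (seg m 1 p)) =
    \sum_(1 <= i < p.+1)
      gword (seg n 2 i) (rcons (seg m 1 i.-1) 0%N) * f (z ^+ m i)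
        * gword (seg n i.+1 p) (0%N :: seg m i.+1 p)
    + \sum_(2 <= i < p.+1)
      gword (seg n 2 i.-1) (seg m 1 i.-1) * f (x * y ^+ n i)
        * gword (seg n i.+1 p) (seg m i p).
Proof.
case: p => // p _; elim: p => [|p IH].
  rewrite big_nat1 big_geq // addr0 -[seg n 2 1]/[::] -[seg m 1 1]/[:: m 1].
  by rewrite -[seg m 2 1]/[::] -[seg m 1 1.-1]/[::] !gword1 expr0 mul1r mulr1.
(* The induction peels off the last x-block and the last z-block; the older summands are only
   multiplied by them on the right. *)
have step ns ms : size ms = (size ns).+1 ->
    gword (rcons ns (n p.+2)) (rcons ms (m p.+2)) =
    gword ns ms * (x * y ^+ n p.+2) * z ^+ m p.+2.
  case/lastP: ms => // ms a; rewrite size_rcons => -[sz].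
  by rewrite -gword1 gword_join // -!cats1 -!catA.
rewrite (seg_rcons n (a := 2)) // (seg_rcons m (a := 1)) //.
rewrite step ?size_seg ?subSS ?subn0 ?subn1 // fM fM IH.
rewrite [X in _ = X + _]big_nat_recr //= [X in _ = _ + X]big_nat_recr //=.
rewrite (seg_nil n (a := p.+3)) // (seg_nil m (a := p.+3)) // (seg_cons m (a := p.+2)) //.
rewrite (seg_nil m (a := p.+3)) // !gword1 expr0 mulr1 (seg_rcons n (a := 2) (b := p.+1)) //.
have -> : gword (rcons (seg n 2 p.+1) (n p.+2)) (rcons (seg m 1 p.+1) 0%N) =
    gword (seg n 2 p.+1) (seg m 1 p.+1) * (x * y ^+ n p.+2).
  rewrite (seg_rcons m) // -[RHS]mulr1 -(expr0 z) -gword1 gword_join ?size_seg ?subSS ?subn0 //.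
  by rewrite -!cats1 -!catA.
set T := _ * f (z ^+ m p.+2).
have comb (S1 S2 S1' S2' U : R) : S1 * (x * y ^+ n p.+2) * z ^+ m p.+2 = S1' ->
  S2 * (x * y ^+ n p.+2) * z ^+ m p.+2 = S2' ->
  T + (U + (S1 + S2) * (x * y ^+ n p.+2)) * z ^+ m p.+2 = S1' + T + (S2' + U * z ^+ m p.+2).
  by move=> <- <-; rewrite !mulrDl; abel.
apply: comb.
- rewrite !mulr_suml; apply: eq_big_nat => i /andP [i1 ip].
  rewrite !(seg_rcons _ (b := p.+1)) // -rcons_cons step ?mulrA //.
  by rewrite /= !size_seg.
- rewrite !mulr_suml; apply: eq_big_nat => i /andP [i1 ip].
  rewrite !(seg_rcons _ (b := p.+1)) ?step ?mulrA //; last by rewrite ltnW.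
  by rewrite !size_seg; lia.
Qed.

End Words.

(** * Hochschild classes through a presentation of the algebra *)

Section Presentation.
Variables (k : fieldType) (F : lalgType k) (A : algType k) (X Y Z : F).
Hypothesis F_scaleAr : forall c (p q : F), c *: (p * q) = p * (c *: q).
Hypothesis F_ind : forall P : F -> Prop,
  (forall c p q, P p -> P q -> P (c *: p + q)) -> P 1 ->
  (forall p, P p -> P (X * p)) -> (forall p, P p -> P (Y * p)) ->
  (forall p, P p -> P (Z * p)) -> forall p, P p.
Hypothesis F_rec : forall (W : lmodType k) (w : W) (LX LY LZ : W -> W),
  linear LX -> linear LY -> linear LZ -> exists E : F -> W,
  [/\ linear E, E 1 = w, forall p, E (X * p) = LX (E p),
      forall p, E (Y * p) = LY (E p) & forall p, E (Z * p) = LZ (E p)].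

Variables (pi : {lrmorphism F -> A}) (s : A -> F).
Hypothesis sK : forall a, pi (s a) = a.
Hypothesis pi_yx : pi (X * X + Y * X) = 0.
Hypothesis pi_xz : pi (X * Z) = 0.
Hypothesis pi_zy : pi (Z * Y) = 0.
Hypothesis ker_ind : forall P : F -> Prop,
  P (X * X + Y * X) -> P (X * Z) -> P (Z * Y) -> P 0 ->
  (forall p q, P p -> P q -> P (p + q)) -> (forall p q, P q -> P (p * q)) ->
  (forall p q, P p -> P (p * q)) -> forall p, pi p = 0 -> P p.

Local Notation x := (pi X).
Local Notation y := (pi Y).
Local Notation z := (pi Z).

Lemma pres_xx : x * x = - (y * x).
Proof. by apply/eqP; rewrite -addr_eq0 -pi_yx rmorphD !rmorphM. Qed.

Lemma pres_xz : x * z = 0. Proof. by rewrite -pi_xz rmorphM. Qed.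
Lemma pres_zy : z * y = 0. Proof. by rewrite -pi_zy rmorphM. Qed.

Lemma pres_zxx : z * x * x = 0.
Proof. by rewrite -mulrA pres_xx mulrN mulrA pres_zy mul0r oppr0. Qed.

(** Recursion on the first letter with access to the tail: [F_rec] is run on pairs (tail, value),
    whose first component reproduces the argument. Both coordinates vary together, so the step only
    has to be linear in the pair. *)
Lemma free_prec (W : lmodType k) (w : W) (MX MY MZ : F -> W -> W) :
  (forall c p p' u u', MX (c *: p + p') (c *: u + u') = c *: MX p u + MX p' u') ->
  (forall c p p' u u', MY (c *: p + p') (c *: u + u') = c *: MY p u + MY p' u') ->
  (forall c p p' u u', MZ (c *: p + p') (c *: u + u') = c *: MZ p u + MZ p' u') ->
  exists E : {linear F -> W}, [/\ E 1 = w, forall p, E (X * p) = MX p (E p),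
      forall p, E (Y * p) = MY p (E p) & forall p, E (Z * p) = MZ p (E p)].
Proof.
move=> linX linY linZ.
pose L (T : F) (M : F -> W -> W) (v : F * W) := (T * v.1, M v.1 v.2).
have linL T M : (forall c p p' u u', M (c *: p + p') (c *: u + u') =
    c *: M p u + M p' u') -> linear (L T M).
  move=> linM c [p u] [p' u']; congr (_, _) => /=; last exact: linM.
  by rewrite mulrDr F_scaleAr.
have [E [linE E1 EX EY EZ]] :=
  F_rec (1, w) (linL X _ linX) (linL Y _ linY) (linL Z _ linZ).
have E1st p : (E p).1 = p.
  elim/F_ind: p => [c p q Ep Eq||p Ep|p Ep|p Ep].
  - by rewrite linE /= Ep Eq.
  - by rewrite E1.
  - by rewrite EX /= Ep.
  - by rewrite EY /= Ep.
  - by rewrite EZ /= Ep.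
have [E' E'E] : exists E' : {linear F -> W}, E' =1 fun p => (E p).2.
  by apply: linear_bundle => c p q /=; rewrite linE.
by exists E'; split=> [|p|p|p]; rewrite !E'E ?E1 ?EX ?EY ?EZ /= ?E1st.
Qed.

Lemma free_derivation_ex (a b c : F) : exists D : {linear F -> F},
  [/\ forall p q, D (p * q) = p * D q + D p * q, D X = a, D Y = b & D Z = c].
Proof.
have lin (T d : F) (e : k) p p' u u' : d * (e *: p + p') + T * (e *: u + u') =
    e *: (d * p + T * u) + (d * p' + T * u').
  by rewrite !mulrDr -!F_scaleAr scalerDr addrACA.
have [D [D1 DX DY DZ]] := free_prec 0 (lin X a) (lin Y b) (lin Z c).
have DT T d : (forall p, D (T * p) = d * p + T * D p) -> D T = d.
  by move=> DT; rewrite -[T]mulr1 DT D1 mulr0 mulr1 addr0.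
exists D; split; [|exact: DT..].
move=> p q; elim/F_ind: p => [e p p' Ep Ep'||p Ep|p Ep|p Ep].
- by rewrite mulrDl -scalerAl !linearP /= Ep Ep' !mulrDl scalerDr -!scalerAl addrACA.
- by rewrite D1 mul0r !mul1r addr0.
all: by rewrite -mulrA !(DX, DY, DZ) Ep; ncring.
Qed.

Definition lifts (g : A -> A -> A) (G : F -> A) :=
  forall p q, G (p * q) = pi p * G q + G p * pi q + g (pi p) (pi q).

Definition koszul_values (G : F -> A) := (G (X * X + Y * X), G (X * Z), G (Z * Y)).

(** The relations are quadratic, so one use of [lifts] splits the value on a relation into a value
    of [g] and the coboundary of [G] on the letters. *)
Lemma lifts_values g (G : {linear F -> A}) : 
  (forall b, linear (g^~ b)) -> lifts g G ->
  koszul_values G = (g (x + y) x, g x z, g z y) + kd1 x y z (G X, G Y, G Z).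
Proof.
move=> ling Gg; have gD a a' b : g (a + a') b = g a b + g a' b.
  by have := ling b 1 a a'; rewrite !scale1r.
by congr (_, _, _) => /=; rewrite ?linearD /= !Gg ?gD; ncring.
Qed.

(** The values of [G] on the letters are free. Taking minus the cochain by which [g] differs from
    [u] makes the values on the relations equal to [u] exactly, not only up to a coboundary. *)
Lemma hh2_lift g u : hh2_class x y z g u ->
  exists2 G : {linear F -> A}, lifts g G & koszul_values G = u.
Proof.
case=> [[ling ling' g1 g1'] gcoc [[[a b] c] gu]].
have lin (T : F) (d : A) (e : k) p p' u1 u' :
    pi T * (e *: u1 + u') + (- d * pi (e *: p + p') + g (pi T) (pi (e *: p + p'))) =
    e *: (pi T * u1 + (- d * pi p + g (pi T) (pi p)))
      + (pi T * u' + (- d * pi p' + g (pi T) (pi p'))).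
  by rewrite linearP /= ling !mulrDr -!scalerAr !scalerDr; abel.
have [G [G1 GX GY GZ]] := free_prec 0 (lin X a) (lin Y b) (lin Z c).
have GT T d : (forall p, G (T * p) = pi T * G p + (- d * pi p + g (pi T) (pi p))) ->
  G T = - d.
  by move=> GT; rewrite -[T]mulr1 GT G1 mulr0 rmorph1 g1' mulr1 addr0 add0r.
have Gg : lifts g G.
  have step T d p q : (forall p, G (T * p) = pi T * G p + (- d * pi p + g (pi T) (pi p))) ->
      G (p * q) = pi p * G q + G p * pi q + g (pi p) (pi q) ->
      G (T * p * q) = pi (T * p) * G q + G (T * p) * pi q + g (pi (T * p)) (pi q).
    move=> GTp Epq; rewrite -mulrA !GTp Epq !rmorphM /=.
    (* The cocycle identity at (letter, [p], [q]) reassociates the terms in [g]. *)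
    have gE : pi T * g (pi p) (pi q) = g (pi T * pi p) (pi q)
        - g (pi T) (pi p * pi q) + g (pi T) (pi p) * pi q.
      by apply/eqP; rewrite -subr_eq0 -(gcoc (pi T) (pi p) (pi q)); apply/eqP; abel.
    by rewrite !mulrDr gE; ncring.
  move=> p q; elim/F_ind: p => [e p p' Ep Ep'||p Ep|p Ep|p Ep].
  - rewrite mulrDl -scalerAl !linearP /= Ep Ep'.
    by rewrite ling' !mulrDl !scalerDr -!scalerAl; abel.
  - by rewrite G1 rmorph1 mul0r !mul1r g1 !addr0.
  - exact: step GX _.
  - exact: step GY _.
  - exact: step GZ _.
exists G => //; rewrite (lifts_values ling' Gg) gu (GT X a) // (GT Y b) // (GT Z c) //.
rewrite -addrA -kd1D; have -> : (a, b, c) + (- a, - b, - c) = 0 :> A * A * A.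
  by congr (_, _, _); rewrite /= addrN.
have -> : kd1 x y z 0 = 0 by congr (_, _, _) => /=; ncring.
by rewrite addr0.
Qed.

Lemma lift_hh2 g (G : {linear F -> A}) u psi :
  [/\ forall a, linear (g a), forall b, linear (g^~ b),
      forall b, g 1 b = 0 & forall a, g a 1 = 0] ->
  (forall a b c, a * g b c - g (a * b) c + g a (b * c) - g a b * c = 0) ->
  lifts g G -> koszul_values G = u + kd1 x y z psi -> hh2_class x y z g u.
Proof.
move=> red coc Gg GE; split=> //; exists (psi - (G X, G Y, G Z)).
have ling' : forall b, linear (g^~ b) by case: red.
have -> : (g (x + y) x, g x z, g z y) = koszul_values G - kd1 x y z (G X, G Y, G Z).
  by rewrite (lifts_values ling' Gg) addrK.
rewrite GE kd1D addrA; congr (_ + _).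
by congr (_, _, _) => /=; ncring.
Qed.

(** The map [p - N p] projects onto the ideal along the normal forms, and [U] restricts to a
    bimodule map there. The hypothesis is consistency on the overlap (x + y) x z: as r1 times z it
    goes to [v * z], as x + y times xz to 0. *)
Lemma splitting_ex (v : A) : v * z = 0 ->
  exists N : {linear F -> F}, exists U : {linear F -> A},
  [/\ N 1 = 1, forall p, pi (N p) = pi p & forall p, pi p = 0 -> N p = 0] /\
  [/\ forall p q, pi q = 0 -> U (p * q) = pi p * U q,
      forall p q, pi p = 0 -> U (p * q) = U p * pi q &
      koszul_values U = (v, 0, 0)].
Proof.
move=> vz.
have [Dx [Dx1 DxX DxY DxZ]] : exists D : {linear F -> F}, [/\ D 1 = 0,
    forall p, D (X * p) = p, forall p, D (Y * p) = 0 & forall p, D (Z * p) = 0].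
  by apply: (free_prec 0 (MX := fun p _ => p) (MY := fun _ _ => 0) (MZ := fun _ _ => 0))
    => *; rewrite ?scaler0 ?addr0.
have [Dy [Dy1 DyX DyY DyZ]] : exists D : {linear F -> F}, [/\ D 1 = 0,
    forall p, D (X * p) = 0, forall p, D (Y * p) = p & forall p, D (Z * p) = 0].
  by apply: (free_prec 0 (MX := fun _ _ => 0) (MY := fun p _ => p) (MZ := fun _ _ => 0))
    => *; rewrite ?scaler0 ?addr0.
have [Dz [Dz1 DzX DzY DzZ]] : exists D : {linear F -> F}, [/\ D 1 = 0,
    forall p, D (X * p) = 0, forall p, D (Y * p) = 0 & forall p, D (Z * p) = p].
  by apply: (free_prec 0 (MX := fun _ _ => 0) (MY := fun _ _ => 0) (MZ := fun p _ => p))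
    => *; rewrite ?scaler0 ?addr0.
(* [N] computes normal forms, which avoid YX, XZ, ZY and ZXX; [Dx], [Dy] and [Dz]
   strip a first letter. *)
have [N [N1 NX NY NZ]] : exists N : {linear F -> F}, [/\ N 1 = 1,
    forall p, N (X * p) = X * (N p - Z * Dz (N p)),
    forall p, N (Y * p) = Y * (N p - X * Dx (N p)) - X * (X * Dx (N p)) &
    forall p, N (Z * p) = Z * (N p - Y * Dy (N p) - X * (X * Dx (Dx (N p))))].
  apply: (free_prec 1 (MX := fun _ n => X * (n - Z * Dz n))
    (MY := fun _ n => Y * (n - X * Dx n) - X * (X * Dx n))
    (MZ := fun _ n => Z * (n - Y * Dy n - X * (X * Dx (Dx n))))) => c p p' n n';
  rewrite ?linearP /= ?linearP /= !(scalerBr, scalerDr, F_scaleAr); ncring.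
have piN p : pi (N p) = pi p.
  elim/F_ind: p => [c p q Ep Eq||p Ep|p Ep|p Ep].
  - by rewrite !linearP /= Ep Eq.
  - by rewrite N1.
  - by rewrite NX !(rmorphM, rmorphB) /= Ep mulrBr mulrA pres_xz mul0r subr0.
  - rewrite NY !(rmorphM, rmorphB) /= Ep mulrBr !mulrA pres_xx mulNr opprK.
    by rewrite addrNK.
  - rewrite NZ !(rmorphM, rmorphB) /= Ep !mulrBr !mulrA pres_zxx pres_zy.
    by rewrite !mul0r !subr0.
(* On the ideal, [U] is to be the bimodule map with r1 |-> v: the corrections are
   its values on YX + XX and on ZXX = Z r1 - (ZY) X. *)
have [U [U1 UX UY UZ]] : exists U : {linear F -> A}, [/\ U 1 = 0,
    forall p, U (X * p) = x * U p,
    forall p, U (Y * p) = y * U p + v * pi (Dx (N p)) &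
    forall p, U (Z * p) = z * U p + z * v * pi (Dx (Dx (N p)))].
  apply: (free_prec 0 (MX := fun _ u => x * u)
    (MY := fun p u => y * u + v * pi (Dx (N p)))
    (MZ := fun p u => z * u + z * v * pi (Dx (Dx (N p))))) => c p p' u u';
  by rewrite ?linearP /= ?linearP /= ?linearP /= ?linearP /= ?mulrDr -?scalerAr ?scalerDr; abel.
(* Confluence of the rewriting system takes the form of three computations: [N] kills each relation
   followed by an arbitrary [q]. *)
have NR q : N ((X * X + Y * X) * q) = 0.
  rewrite mulrDl linearD -!mulrA NX NY NX DxX DzX !mulr0 !subr0 /=.
  by rewrite !subrr mulr0 sub0r addrN.
have NXZ q : N (X * Z * q) = 0 by rewrite -mulrA NX NZ DzZ subrr mulr0.
have DxNY q : Dx (N (Y * q)) = - (X * Dx (N q)).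
  by rewrite NY linearB DxY DxX /= sub0r.
have DxDxNY q : Dx (Dx (N (Y * q))) = - Dx (N q) by rewrite DxNY linearN /= DxX.
have DyNY q : Dy (N (Y * q)) = N q - X * Dx (N q).
  by rewrite NY linearB DyY DyX /= subr0.
have NZY q : N (Z * Y * q) = 0.
  by rewrite -mulrA NZ DxDxNY DyNY NY; ncring.
(* The recursion for [N] and the corrections in [U] see the tail only through its normal form. Where
   that is 0, [N] stays 0 on left multiples and [U] becomes left linear. *)
have N_left p q : N q = 0 -> N (p * q) = 0.
  move=> Nq; elim/F_ind: p => [c p p' Ep Ep'||p Ep|p Ep|p Ep].
  - by rewrite mulrDl -scalerAl linearP /= Ep Ep' scaler0 addr0.
  - by rewrite mul1r.
  - by rewrite -mulrA NX Ep !linear0 !(mulr0, subr0).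
  - by rewrite -mulrA NY Ep !linear0 !(mulr0, subr0).
  - by rewrite -mulrA NZ Ep !linear0 !(mulr0, subr0).
have U_left p q : N q = 0 -> U (p * q) = pi p * U q.
  move=> Nq; elim/F_ind: p => [c p p' Ep Ep'||p Ep|p Ep|p Ep].
  - by rewrite mulrDl -scalerAl !linearP /= Ep Ep' mulrDl scalerAl.
  - by rewrite mul1r rmorph1 mul1r.
  - by rewrite -mulrA UX Ep rmorphM mulrA.
  - by rewrite -mulrA UY Ep (N_left _ _ Nq) !linear0 mulr0 addr0 rmorphM mulrA.
  - by rewrite -mulrA UZ Ep (N_left _ _ Nq) !linear0 mulr0 addr0 rmorphM mulrA.
(* The letter Z that [N] strips after X leaves a term in [v * z]; this is where the hypothesis
   enters. *)
have UR q : U ((X * X + Y * X) * q) = v * pi q.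
  rewrite mulrDl linearD -!mulrA /= UY !UX NX DxX !rmorphB rmorphM /= piN.
  rewrite !mulrBr [v * (z * _)]mulrA vz mul0r subr0 !mulrA pres_xx.
  by rewrite mulNr addrA addNr add0r.
have UXZ q : U (X * Z * q) = 0.
  by rewrite -mulrA UX UZ mulrDr !mulrA pres_xz !mul0r addr0.
(* The corrections made on Y and on Z are opposite here, by [DxDxNY]. *)
have UZY q : U (Z * Y * q) = 0.
  rewrite -mulrA UZ UY DxDxNY rmorphN /= mulrDr mulrA pres_zy.
  by ncring.
(* The right factor [q] is quantified inside the induction, because recursion on the first letter
   gives no direct hold on right multiplication. *)
have ker p : pi p = 0 -> forall q, N (p * q) = 0 /\ U (p * q) = U p * pi q.
  move: p; apply: (ker_ind (P := fun p => forall q, N (p * q) = 0 /\ U (p * q) = U p * pi q))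
    => [||||p p' IHp IHp'|p p' IHp|p p' IHp].
  - by move=> q; rewrite NR UR -[_ + _]mulr1 UR rmorph1 mulr1.
  - by move=> q; rewrite NXZ UXZ -[X * Z]mulr1 UXZ mul0r.
  - by move=> q; rewrite NZY UZY -[Z * Y]mulr1 UZY mul0r.
  - by move=> q; rewrite mul0r !linear0 mul0r.
  - move=> q; have [Np Up] := IHp q; have [Np' Up'] := IHp' q.
    by rewrite mulrDl !linearD /= Np Np' Up Up' addr0 mulrDl.
  - have Np' : N p' = 0 by rewrite -[p']mulr1; case: (IHp 1).
    move=> q; have [Npq Upq] := IHp q.
    by rewrite -mulrA (N_left p _ Npq) (U_left p _ Npq) (U_left p _ Np') Upq mulrA.
  - by move=> q; rewrite -mulrA; have [-> ->] := IHp (p' * q); have [_ ->] := IHp p'; 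
      rewrite rmorphM mulrA.
have kerN p : pi p = 0 -> N p = 0 by move=> /ker/(_ 1); rewrite mulr1; case.
exists N, U; split=> //; split.
- by move=> p q /kerN; apply: U_left.
- by move=> p q /ker/(_ q) [].
- congr (_, _, _); first by rewrite -[_ + _]mulr1 UR rmorph1 mulr1.
    by rewrite -[_ * _]mulr1 UXZ.
  by rewrite -[_ * _]mulr1 UZY.
Qed.

(** The failure of the section [S] to be multiplicative, [S a * S b - S (a * b)], lies in the ideal
    and satisfies the cocycle identity there; the bimodule map [U] carries it to a cocycle with
    values in [A]. *)
Lemma hh2_class_ex (v : A) : v * z = 0 -> exists g, hh2_class x y z g (v, 0, 0).
Proof.
move=> vz; have [N [U [[N1 piN kerN] [U_left U_right UE]]]] := splitting_ex vz.
(* [s] is only a set-theoretic section; composing with [N], which depends only on the class, makes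
   it linear. *)
pose S a := N (s a).
have Spi p : S (pi p) = N p.
  by apply/eqP; rewrite -subr_eq0 -linearB; apply/eqP/kerN; rewrite rmorphB /= sK subrr.
have piS a : pi (S a) = a by rewrite /S piN sK.
have linS : linear S.
  by move=> c a b; rewrite -{1}(piS a) -{1}(piS b) -linearP Spi linearP /= -!Spi !piS.
have S1 : S 1 = 1 by rewrite -(rmorph1 pi) Spi.
pose g a b := U (S a * S b - S (a * b)).
have ker_SS a b : pi (S a * S b - S (a * b)) = 0.
  by rewrite rmorphB rmorphM /= !piS subrr.
have [lS lSE] := linear_bundle linS.
(* Relations have image 0 in [A], so [G] and [U] have the same Koszul values. *)
pose G p := U (p - lS (pi p)).
have linG : linear G.
  move=> c p q; rewrite /G -linearP /=; congr (U _).
  by rewrite !linearP /= scalerBr; abel.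
have [lG lGE] := linear_bundle linG.
apply: ex_intro (g) (@lift_hh2 g lG _ 0 _ _ _ _).
- split=> [a c b b'|b c a a'|b|a]; rewrite /g -!lSE.
  + rewrite -linearP; congr (U _); rewrite mulrDr -scalerAr !linearP /=.
    by rewrite mulrDr -F_scaleAr scalerBr; abel.
  + rewrite -linearP; congr (U _); rewrite mulrDl -scalerAl !linearP /=.
    by rewrite mulrDl -scalerAl scalerBr; abel.
  + by rewrite !lSE S1 !mul1r subrr linear0.
  + by rewrite !lSE S1 !mulr1 subrr linear0.
- move=> a b c.
  have -> : a * g b c = U (S a * (S b * S c - S (b * c))) by rewrite U_left // piS.
  have -> : g a b * c = U ((S a * S b - S (a * b)) * S c) by rewrite U_right // piS.
  rewrite -!linearB -linearD -linearB /=; rewrite -[RHS](linear0 U); congr (U _).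
  by ncring.
- move=> p q; rewrite !lGE /G !lSE.
  have kS r : pi (r - S (pi r)) = 0 by rewrite rmorphB /= piS subrr.
  have -> : pi p * U (q - S (pi q)) = U (p * (q - S (pi q))) by rewrite U_left.
  have -> : U (p - S (pi p)) * pi q = U ((p - S (pi p)) * S (pi q)).
    by rewrite U_right // piS.
  by rewrite -!linearD /=; congr (U _); rewrite rmorphM /=; ncring.
- have -> : kd1 x y z 0 = 0 by congr (_, _, _) => /=; ncring.
  rewrite addr0 -UE /koszul_values !lGE /G pi_yx pi_xz pi_zy linear0.
  by rewrite !subr0.
Qed.

(** * Existence of derivations and reduction of the bracket to the relations *)

Definition derivation (f : A -> A) := forall a b, f (a * b) = a * f b + f a * b.

Definition relation_bimodule (G : F -> A) :=
  (forall p q, pi q = 0 -> G (p * q) = pi p * G q) /\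
  (forall p q, pi p = 0 -> G (p * q) = G p * pi q).

(** The three components of the cocycle condition are the images of [D] on the three relations, so
    [D] preserves the ideal and descends to [A]. *)
Lemma hh1_class_ex (a b c : F) : kd1 x y z (pi a, pi b, pi c) = 0 ->
  exists f, hh1_class x y z f (pi a, pi b, pi c).
Proof.
case=> d1 d2 d3.
have [D [DM DX DY DZ]] := free_derivation_ex a b c.
have kerD p : pi p = 0 -> pi (D p) = 0.
  (* Membership in the ideal is carried along: Leibniz on a multiple of an ideal element leaves that
     element itself as a factor of one term. *)
  suff ker q : pi q = 0 -> pi (D q) = 0 /\ pi q = 0 by move=> /ker [].
  move: q; apply: (ker_ind (P := fun q => pi (D q) = 0 /\ pi q = 0))
    => [||||p' q [Dp pp] [Dq pq]|p' q [Dq pq]|p' q [Dp pp]]; split=> //.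
  - rewrite linearD rmorphD !DM !rmorphD !rmorphM DX DY /= -d1; ncring.
  - by rewrite DM rmorphD !rmorphM DX DZ /= -d2 addrC.
  - by rewrite DM rmorphD !rmorphM DZ DY /= -d3 addrC.
  - by rewrite !linear0.
  - by rewrite linear0.
  - by rewrite linearD rmorphD /= Dp Dq addr0.
  - by rewrite rmorphD /= pp pq addr0.
  - by rewrite DM rmorphD !rmorphM /= Dq pq !mulr0 addr0.
  - by rewrite rmorphM /= pq mulr0.
  - by rewrite DM rmorphD !rmorphM /= Dp pp !mul0r addr0.
  - by rewrite rmorphM /= pp mul0r.
have piD p : pi (D (s (pi p))) = pi (D p).
  apply/eqP; rewrite -subr_eq0 -rmorphB -linearB; apply/eqP/kerD.
  by rewrite rmorphB /= sK subrr.
exists (fun e => pi (D (s e))); split.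
- have D1 : D 1 = 0 by apply: (addrI (D 1)); rewrite addr0 -{3}[1]mulr1 DM mul1r mulr1.
  split; last by rewrite -(rmorph1 pi) piD D1 rmorph0.
  by move=> e p q; rewrite -{1}(sK p) -{1}(sK q) -linearP piD !linearP.
- move=> p q; rewrite -{2}(sK p) -{2}(sK q) -rmorphM piD DM rmorphD !rmorphM /= !sK.
  by abel.
- exists 0; rewrite !piD DX DY DZ; congr (_, _, _) => /=; ncring.
Qed.

(** The identity for the bracket is minus [f] of the identity for [g], plus the identity for [g]
    with [f] applied to each of the three arguments in turn. *)
Lemma bracket_cocycle g (f : {linear A -> A}) : derivation f ->
  (forall a, linear (g a)) -> (forall b, linear (g^~ b)) ->
  (forall a b c, a * g b c - g (a * b) c + g a (b * c) - g a b * c = 0) ->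
  forall a b c, a * bracket g f b c - bracket g f (a * b) c
    + bracket g f a (b * c) - bracket g f a b * c = 0.
Proof.
move=> fM gl gl' coc a b c.
have gDl d d' e : g (d + d') e = g d e + g d' e by have := gl' e 1 d d'; rewrite !scale1r.
have gDr d e e' : g d (e + e') = g d e + g d e' by have := gl d 1 e e'; rewrite !scale1r.
transitivity (- f (a * g b c - g (a * b) c + g a (b * c) - g a b * c)
  + (f a * g b c - g (f a * b) c + g (f a) (b * c) - g (f a) b * c)
  + (a * g (f b) c - g (a * f b) c + g a (f b * c) - g a (f b) * c)
  + (a * g b (f c) - g (a * b) (f c) + g a (b * f c) - g a b * f c)).
  by rewrite /bracket !(linearD, linearN) /= !fM !gDl !gDr; ncring.
by rewrite !coc linear0 oppr0 !addr0.
Qed.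

Lemma bracket_reduced g (f : {linear A -> A}) : derivation f ->
  [/\ forall a, linear (g a), forall b, linear (g^~ b),
      forall b, g 1 b = 0 & forall a, g a 1 = 0] ->
  [/\ forall a, linear (bracket g f a), forall b, linear ((bracket g f)^~ b),
      forall b, bracket g f 1 b = 0 & forall a, bracket g f a 1 = 0].
Proof.
move=> fM [gl gl' g1 g1'].
have f1 : f 1 = 0 by apply: (addrI (f 1)); rewrite addr0 -{3}[1]mulr1 fM mul1r mulr1.
have [g0 g0'] : (forall b, g 0 b = 0) /\ (forall a, g a 0 = 0).
  by split=> e; [have := gl' e (-1) 1 1|have := gl e (-1) 1 1];
    rewrite scaleN1r addNr ?g1 ?g1' scaler0 addr0.
split=> [a c b b'|b c a a'|b|a]; rewrite /bracket.
- by rewrite !linearP /= !gl !linearP /= scalerBr scalerDr; abel.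
- by rewrite !linearP /= !gl' !linearP /= scalerBr scalerDr; abel.
- by rewrite f1 g0 !g1 linear0 addr0 subr0.
- by rewrite f1 g0' !g1' linear0 addr0 subr0.
Qed.

(** The cochain in the hypothesis lists [G (D r) - f (G r)] over the relations [r], for the
    derivation [D] with values [a], [b], [c] on the letters; [f] appears only at r1 because [G] is 0
    on the other two. There [f] has the exact Koszul values: arbitrary representatives are dealt
    with in the proof. *)
Lemma bracket_intro (v : A) (a b c : F) (w : A * A * A) :
  v * z = 0 -> kd1 x y z (pi a, pi b, pi c) = 0 ->
  (forall (G : {linear F -> A}) (f : {linear A -> A}),
     relation_bimodule G -> koszul_values G = (v, 0, 0) ->
     derivation f -> f x = pi a -> f y = pi b -> f z = pi c ->
     exists psi, (G ((a + b) * X + (X + Y) * a) - f v,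
                  G (a * Z + X * c), G (c * Y + Z * b)) = w + kd1 x y z psi) ->
  hh_bracket x y z (v, 0, 0) (pi a, pi b, pi c) w.
Proof.
move=> vz d1 H; split; [exact: hh2_class_ex|exact: hh1_class_ex|].
move=> g f0 gu [[lf f1] fcoc [e fE]]; have [f ff0] := linear_bundle lf.
have fM : derivation f.
  move=> p q; rewrite !ff0; apply/eqP; rewrite -subr_eq0 -oppr_eq0 -(fcoc p q).
  by apply/eqP; abel.
have f0E : f0 = f by apply: boolp.funext => t; rewrite ff0.
rewrite {}f0E {ff0 lf f1 fcoc} in fE *.
have [gred gcoc _] := gu; have [gl gl' g1 g1'] := gred.
have [G Gg GE] := hh2_lift gu.
have [G1 G2 G3] := GE.
(* [D] lifts [f] itself, inner part included; [e] is the element whose coboundary separates [f] from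
   the Koszul cochain. *)
have [D [DM DX DY DZ]] := free_derivation_ex (a + (X * s e - s e * X))
  (b + (Y * s e - s e * Y)) (c + (Z * s e - s e * Z)).
have [fx fy fz] := fE.
have [g0 g0'] : (forall b, g 0 b = 0) /\ (forall a, g a 0 = 0).
  by split=> t; [have := gl' t (-1) 1 1|have := gl t (-1) 1 1];
    rewrite scaleN1r addNr ?g1 ?g1' scaler0 addr0.
have Gbim : relation_bimodule G.
  by split=> p q pq; rewrite Gg pq ?mulr0 ?mul0r ?g0 ?g0' ?addr0 ?add0r.
have [G_left G_right] := Gbim.
have f1 : f 1 = 0 by apply: (addrI (f 1)); rewrite addr0 -{3}[1]mulr1 fM mul1r mulr1.
have D1 : D 1 = 0 by apply: (addrI (D 1)); rewrite addr0 -{3}[1]mulr1 DM mul1r mulr1.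
have piD p : pi (D p) = f (pi p).
  elim/F_ind: p => [d p q Ep Eq||p Ep|p Ep|p Ep].
  - by rewrite !linearP /= Ep Eq.
  - by rewrite D1 rmorph1 f1 rmorph0.
  - by rewrite DM rmorphD !rmorphM fM /= Ep DX fx rmorphD rmorphB !rmorphM /= sK.
  - by rewrite DM rmorphD !rmorphM fM /= Ep DY fy rmorphD rmorphB !rmorphM /= sK.
  - by rewrite DM rmorphD !rmorphM fM /= Ep DZ fz rmorphD rmorphB !rmorphM /= sK.
(* Removing the inner derivation leaves one with the prescribed values on the letters, to which the
   hypothesis applies. *)
pose ad (t : A) := f t - (t * e - e * t).
have [ad' adE] : exists ad' : {linear A -> A}, ad' =1 ad.
  apply: linear_bundle => d p q; rewrite /ad linearP /= mulrDl mulrDr -scalerAl -scalerAr.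
  by rewrite !scalerBr; abel.
have [psi psiE] : exists psi, (G ((a + b) * X + (X + Y) * a) - ad' v,
    G (a * Z + X * c), G (c * Y + Z * b)) = w + kd1 x y z psi.
  apply: H => //; rewrite ?adE /ad ?fx ?fy ?fz; try by abel.
  by move=> p q; rewrite !adE /ad fM; ncring.
pose Psi p := G (D p) - f (G p).
have [Psi' PsiE] : exists Psi' : {linear F -> A}, Psi' =1 Psi.
  by apply: linear_bundle => d p q; rewrite /Psi !linearP /= scalerBr; abel.
apply: (@lift_hh2 _ Psi' _ psi).
- exact: bracket_reduced.
- exact: bracket_cocycle.
- move=> p q; rewrite !PsiE /Psi DM linearD !Gg !linearD /= !fM !piD /bracket.
  by ncring.
(* On a relation the inner part of [D] contributes the commutator of [G p] with [e], exactly what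
   turns [f] into [ad']. *)
have rel p : pi p = 0 -> G (p * s e) - G (s e * p) = G p * e - e * G p.
  by move=> pp; rewrite G_right // G_left // sK.
have commR p q : G (p + (q * s e - s e * q)) = G p + (G (q * s e) - G (s e * q)).
  by rewrite linearD linearB.
rewrite -psiE /koszul_values !PsiE /Psi G1 G2 G3 !linear0 !addr0 adE /ad.
congr (_, _, _).
- have -> : D (X * X + Y * X) = ((a + b) * X + (X + Y) * a)
      + ((X * X + Y * X) * s e - s e * (X * X + Y * X)).
    by rewrite linearD !DM DX DY /=; ncring.
  by rewrite commR rel // G1; abel.
- have -> : D (X * Z) = (a * Z + X * c) + ((X * Z) * s e - s e * (X * Z)).
    by rewrite DM DX DZ; ncring.
  by rewrite commR rel // G2 mul0r mulr0 subr0 addr0.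
- have -> : D (Z * Y) = (c * Y + Z * b) + ((Z * Y) * s e - s e * (Z * Y)).
    by rewrite DM DZ DY; ncring.
  by rewrite commR rel // G3 mul0r mulr0 subr0 addr0.
Qed.

(** * Identities in the algebra and values of bimodule maps on the ideal *)

Lemma pres_yx : y * x = - (x * x).
Proof. by rewrite pres_xx opprK. Qed.

Lemma pres_xyx m : x * y ^+ m * x = - (y ^+ m.+1 * x).
Proof.
elim: m => [|m IH]; first by rewrite expr0 mulr1 pres_xx expr1.
rewrite [y ^+ m.+1]exprSr mulrA -[_ * y * x]mulrA pres_yx mulrN mulrA IH mulNr opprK.
by rewrite -[_ * x * x]mulrA pres_xx mulrN mulrA -exprSr.
Qed.

Lemma pres_zyS m : z * y ^+ m.+1 = 0.
Proof. by rewrite exprS mulrA pres_zy mul0r. Qed.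

Lemma pres_zxyx m : z * x * y ^+ m * x = 0.
Proof. by rewrite -!mulrA (mulrA x) pres_xyx mulrN mulrA pres_zyS mul0r oppr0. Qed.

Lemma pres_xy_yx m : (x + y) * y ^+ m * x = 0.
Proof. by rewrite !mulrDl pres_xyx -exprS addNr. Qed.

Lemma pres_yxx m : y ^+ m * x * x = - (y ^+ m.+1 * x).
Proof. by rewrite -mulrA pres_xx mulrN mulrA -exprSr. Qed.

(* The value on [(X + Y) * Y ^+ m * X] of a bimodule map on the ideal with
   [(X + Y) * X |-> v]. *)
Fixpoint tau (v : A) (m : nat) : A :=
  if m is m'.+1 then (x + y) * y ^+ m' * v - tau v m' * x else v.

Lemma tau_x m : tau x m = y ^+ m * x.
Proof.
elim: m => [|m IH] /=; first by rewrite mul1r.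
by rewrite pres_xy_yx IH pres_yxx opprK add0r.
Qed.

(** Right multiplication by x kills every [tau v n] as soon as it kills [v], so only the leading
    term of the recursion remains. *)
Lemma tau_word v m : v * x = 0 -> tau v m.+1 = (x + y) * y ^+ m * v.
Proof.
move=> vx; have tx n : tau v n * x = 0.
  elim: n => [|n IH] //=; by rewrite mulrBl IH -[_ * v * x]mulrA vx mulr0 mul0r subr0.
by rewrite /= tx subr0.
Qed.

Section BimoduleValues.
Variables (G : {linear F -> A}) (v : A).
Hypothesis Gbim : relation_bimodule G.
Hypothesis GE : koszul_values G = (v, 0, 0).

Lemma bimodule_yx p q : G (p * (X * X + Y * X) * q) = pi p * v * pi q.
Proof.
case: Gbim GE => Gl Gr [<- _ _].
have pp : pi (p * (X * X + Y * X)) = 0 by rewrite rmorphM /= pi_yx mulr0.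
by rewrite (Gr _ _ pp) (Gl _ _ pi_yx).
Qed.

Lemma bimodule_xz p q : G (p * (X * Z) * q) = 0.
Proof.
case: Gbim GE => Gl Gr [_ G0 _].
have pp : pi (p * (X * Z)) = 0 by rewrite rmorphM /= pi_xz mulr0.
by rewrite (Gr _ _ pp) (Gl _ _ pi_xz) G0 mulr0 mul0r.
Qed.

Lemma bimodule_zy p q : G (p * (Z * Y) * q) = 0.
Proof.
case: Gbim GE => Gl Gr [_ _ G0].
have pp : pi (p * (Z * Y)) = 0 by rewrite rmorphM /= pi_zy mulr0.
by rewrite (Gr _ _ pp) (Gl _ _ pi_zy) G0 mulr0 mul0r.
Qed.

Lemma bimodule_tau p m q :
  G (p * ((X + Y) * Y ^+ m * X) * q) = pi p * tau v m * pi q.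
Proof.
elim: m p q => [|m IH] p q /=.
  by rewrite mulr1 mulrDl bimodule_yx.
(* The final YX is r1 minus XX. *)
have -> : p * ((X + Y) * Y ^+ m.+1 * X) * q =
    (p * (X + Y) * Y ^+ m) * (X * X + Y * X) * q
    - p * ((X + Y) * Y ^+ m * X) * (X * q).
  by rewrite exprSr; ncring.
rewrite linearB bimodule_yx IH !rmorphM rmorphD rmorphXn.
by rewrite mulrBr mulrBl !mulrA.
Qed.

End BimoduleValues.

(** [r] stands for [G] on the derivative of r1. In every family the derivatives of XZ and ZY are 0
    or combinations of multiples of XZ and ZY, which [G] kills; hence the two zero components. *)
Definition resolves (v : A) (phi : A * A * A) (r : A) (w : A * A * A) :=
  forall f : {linear A -> A}, derivation f ->
    f x = phi.1.1 -> f y = phi.1.2 -> f z = phi.2 ->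
    exists psi, (r - f v, 0, 0) = w + kd1 x y z psi.

(** * Brackets of a cocycle (v, 0, 0) with each family in degree -1 *)

Lemma bracket_A1 v w : v * z = 0 -> resolves v (x, y, 0) (v + v) w ->
  hh_bracket x y z (v, 0, 0) (x, y, 0) w.
Proof.
move=> vz; have -> : (x, y, 0) = (x, y, pi 0) by rewrite rmorph0.
move=> H; apply: bracket_intro => //.
  rewrite rmorph0; congr (_, _, _) => /=.
  - by rewrite mulrDl pres_xx; ncring.
  - by rewrite pres_xz mulr0 addr0.
  - by rewrite pres_zy mul0r add0r.
move=> G f Gb GE fM fx fy fz.
have [psi E] := H f fM fx fy fz; exists psi; rewrite -{}E.
have yx := bimodule_yx Gb GE; have xz := bimodule_xz Gb GE; have zy := bimodule_zy Gb GE.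
congr (_ - _, _, _).
- have -> : (X + Y) * X + (X + Y) * X = 1 * (X * X + Y * X) * 1 + 1 * (X * X + Y * X) * 1.
    by ncring.
  by rewrite linearD !yx rmorph1 mul1r mulr1.
- by rewrite mulr0 addr0 -[_ * _]mulr1 -[_ * _]mul1r mulrA xz.
- by rewrite mul0r add0r -[_ * _]mulr1 -[_ * _]mul1r mulrA zy.
Qed.

Lemma bracket_B1 v l w : v * z = 0 ->
  resolves v (y ^+ l * x, y ^+ l.+1, 0) (y ^+ l * v + tau v l) w ->
  hh_bracket x y z (v, 0, 0) (y ^+ l * x, y ^+ l.+1, 0) w.
Proof.
move=> vz; have -> : (y ^+ l * x, y ^+ l.+1, 0) = (pi (Y ^+ l * X), pi (Y ^+ l.+1), pi 0).
  by rewrite rmorph0 rmorphM !rmorphXn.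
move=> H; apply: bracket_intro => //.
  rewrite rmorph0 rmorphM !rmorphXn; congr (_, _, _) => /=.
  - by rewrite mulrDl pres_yxx addNr add0r mulrA pres_xy_yx.
  - by rewrite -mulrA pres_xz !mulr0 addr0.
  - by rewrite mul0r pres_zyS addr0.
move=> G f Gb GE fM fx fy fz; have [psi E] := H f fM fx fy fz; exists psi; rewrite -{}E.
have yx := bimodule_yx Gb GE; have xz := bimodule_xz Gb GE; have zy := bimodule_zy Gb GE.
have ta := bimodule_tau Gb GE.
congr (_ - _, _, _).
- have -> : (Y ^+ l * X + Y ^+ l.+1) * X + (X + Y) * (Y ^+ l * X)
      = Y ^+ l * (X * X + Y * X) * 1 + 1 * ((X + Y) * Y ^+ l * X) * 1.
    by rewrite exprSr; ncring.
  by rewrite linearD yx ta rmorph1 rmorphXn !mulr1 mul1r.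
- have -> : Y ^+ l * X * Z + X * 0 = Y ^+ l * (X * Z) * 1 by ncring.
  by rewrite xz.
- have -> : 0 * Y + Z * Y ^+ l.+1 = 1 * (Z * Y) * Y ^+ l by rewrite exprS; ncring.
  by rewrite zy.
Qed.

Lemma bracket_C1 v l w : v * z = 0 ->
  resolves v (y ^+ l.+1 * x, - (x * y ^+ l.+1), z * x * y ^+ l) (y ^+ l.+1 * v) w ->
  hh_bracket x y z (v, 0, 0) (y ^+ l.+1 * x, - (x * y ^+ l.+1), z * x * y ^+ l) w.
Proof.
move=> vz; have -> : (y ^+ l.+1 * x, - (x * y ^+ l.+1), z * x * y ^+ l) =
    (pi (Y ^+ l.+1 * X), pi (- (X * Y ^+ l.+1)), pi (Z * X * Y ^+ l)).
  by rewrite rmorphN !rmorphM !rmorphXn.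
move=> H; apply: bracket_intro => //.
  rewrite rmorphN !rmorphM !rmorphXn; congr (_, _, _) => /=.
  - rewrite mulrDl mulNr pres_yxx pres_xyx mulrA pres_xy_yx opprK addr0.
    by rewrite addNr.
  - by rewrite -mulrA pres_xz mulr0 !mulrA pres_xz !mul0r addr0.
  - by rewrite mulrN mulrA -[_ * y ^+ l * y]mulrA -exprSr addrN.
move=> G f Gb GE fM fx fy fz; have [psi E] := H f fM fx fy fz; exists psi; rewrite -{}E.
have yx := bimodule_yx Gb GE; have xz := bimodule_xz Gb GE; have zy := bimodule_zy Gb GE.
congr (_ - _, _, _).
- have -> : (Y ^+ l.+1 * X + - (X * Y ^+ l.+1)) * X + (X + Y) * (Y ^+ l.+1 * X)
      = Y ^+ l.+1 * (X * X + Y * X) * 1.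
    by rewrite ?(mulrDl, mulrDr, mulrN, mulNr, mulr1, mulrA) -exprS -exprSr; abel.
  by rewrite yx rmorph1 rmorphXn mulr1.
- have -> : Y ^+ l.+1 * X * Z + X * (Z * X * Y ^+ l) =
     Y ^+ l.+1 * (X * Z) * 1 + 1 * (X * Z) * (X * Y ^+ l) by ncring.
  by rewrite linearD !xz addr0.
- have -> : Z * X * Y ^+ l * Y + Z * - (X * Y ^+ l.+1) = 0 by rewrite exprSr; ncring.
  by rewrite linear0.
Qed.

Lemma bracket_D1 v l j w : v * z = 0 -> (0 < j < l)%N ->
  resolves v (y ^+ l * x, - (y ^+ j * x * y ^+ (l - j)), 0)
    (y ^+ l * v + tau v l - y ^+ j * tau v (l - j)) w ->
  hh_bracket x y z (v, 0, 0) (y ^+ l * x, - (y ^+ j * x * y ^+ (l - j)), 0) w.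
Proof.
move=> vz /andP [j0 jl].
have -> : (y ^+ l * x, - (y ^+ j * x * y ^+ (l - j)), 0) =
    (pi (Y ^+ l * X), pi (- (Y ^+ j * X * Y ^+ (l - j))), pi 0).
  by rewrite rmorph0 rmorphN !rmorphM !rmorphXn.
move=> H; apply: bracket_intro => //.
  rewrite rmorph0 rmorphN !rmorphM !rmorphXn; congr (_, _, _) => /=.
  - have E : y ^+ j * x * y ^+ (l - j) * x = - (y ^+ l.+1 * x).
      by rewrite -2!mulrA (mulrA x) pres_xyx mulrN mulrA -exprD addnS subnKC // ltnW.
    by rewrite mulrDl mulNr E pres_yxx opprK addNr add0r mulrA pres_xy_yx.
  - by rewrite -mulrA pres_xz !mulr0 addr0.
  - by rewrite mul0r mulrN !mulrA -(prednK j0) pres_zyS !mul0r oppr0 addr0.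
move=> G f Gb GE fM fx fy fz; have [psi E] := H f fM fx fy fz; exists psi; rewrite -{}E.
have yx := bimodule_yx Gb GE; have xz := bimodule_xz Gb GE; have zy := bimodule_zy Gb GE.
have ta := bimodule_tau Gb GE.
congr (_ - _, _, _).
- have -> : (Y ^+ l * X + - (Y ^+ j * X * Y ^+ (l - j))) * X + (X + Y) * (Y ^+ l * X)
      = Y ^+ l * (X * X + Y * X) * 1 + 1 * ((X + Y) * Y ^+ l * X) * 1
        - Y ^+ j * ((X + Y) * Y ^+ (l - j) * X) * 1.
    have E : Y ^+ j * Y * Y ^+ (l - j) = Y ^+ l * Y.
      by rewrite -mulrA -exprS -exprD -exprSr addnS subnKC // ltnW.
    by rewrite ?(mulrDl, mulrDr, mulrN, mulNr, mul1r, mulr1, mulrA) E; abel.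
  rewrite linearB linearD /= yx !ta rmorph1 !rmorphXn.
  by rewrite !mulr1 mul1r.
- have -> : Y ^+ l * X * Z + X * 0 = Y ^+ l * (X * Z) * 1 by ncring.
  by rewrite xz.
- have -> : 0 * Y + Z * - (Y ^+ j * X * Y ^+ (l - j)) =
     - (1 * (Z * Y) * (Y ^+ j.-1 * X * Y ^+ (l - j))).
    by rewrite -{1}(prednK j0) exprS; ncring.
  by rewrite linearN zy oppr0.
Qed.

(* The common form of the classes E and F. *)
Lemma bracket_EF1 v (P P1 P2 : F) m w : v * z = 0 -> P = Y * P1 -> P = P2 * Z ->
  resolves v (0, pi P * x * y ^+ m, 0) (pi P * tau v m) w ->
  hh_bracket x y z (v, 0, 0) (0, pi P * x * y ^+ m, 0) w.
Proof.
move=> vz PE1 PE2; have -> : (0, pi P * x * y ^+ m, 0) = (pi 0, pi (P * X * Y ^+ m), pi 0).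
  by rewrite rmorph0 !rmorphM rmorphXn.
move=> H; apply: bracket_intro => //.
  rewrite rmorph0 !rmorphM rmorphXn; congr (_, _, _) => /=.
  - rewrite add0r mulr0 addr0 -!mulrA (mulrA x) pres_xyx PE2 rmorphM -mulrA.
    by rewrite mulrN mulrA pres_zyS mul0r oppr0 mulr0.
  - by rewrite mul0r mulr0 addr0.
  - by rewrite mul0r add0r PE1 rmorphM !mulrA pres_zy !mul0r.
move=> G f Gb GE fM fx fy fz; have [psi E] := H f fM fx fy fz; exists psi; rewrite -{}E.
have zy := bimodule_zy Gb GE; have ta := bimodule_tau Gb GE.
congr (_ - _, _, _).
(* Completing P X Y^m X to P (X + Y) Y^m X costs only a multiple of ZY, because [P] ends in Z. *)
- have -> : (0 + P * X * Y ^+ m) * X + (X + Y) * 0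
      = P * ((X + Y) * Y ^+ m * X) * 1 - P2 * (Z * Y) * (Y ^+ m * X).
    by rewrite PE2; ncring.
  by rewrite linearB zy ta rmorph1 mulr1 subr0.
- by rewrite mul0r mulr0 addr0 linear0.
- have -> : 0 * Y + Z * (P * X * Y ^+ m) = 1 * (Z * Y) * (P1 * X * Y ^+ m).
    by rewrite PE1; ncring.
  by rewrite zy.
Qed.

Lemma bracket_G1 v (P P2 : F) m w : v * z = 0 -> P = P2 * Z ->
  resolves v (0, x * pi P * x * y ^+ m.+1, - (z * x * pi P * x * y ^+ m))
    (x * pi P * tau v m.+1) w ->
  hh_bracket x y z (v, 0, 0)
    (0, x * pi P * x * y ^+ m.+1, - (z * x * pi P * x * y ^+ m)) w.
Proof.
move=> vz PE2.
have -> : (0, x * pi P * x * y ^+ m.+1, - (z * x * pi P * x * y ^+ m)) =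
  (pi 0, pi (X * P * X * Y ^+ m.+1), pi (- (Z * X * P * X * Y ^+ m))).
  by rewrite rmorph0 rmorphN !rmorphM !rmorphXn.
move=> H; apply: bracket_intro => //.
  rewrite rmorph0 rmorphN !rmorphM !rmorphXn; congr (_, _, _) => /=.
  - have E : pi P * y ^+ m.+2 = 0 by rewrite PE2 rmorphM /= -mulrA pres_zyS mulr0.
    rewrite add0r mulr0 addr0 -2!mulrA (mulrA x) pres_xyx.
    by rewrite mulrN mulrA -(mulrA x) E mulr0 mul0r oppr0.
  - by rewrite mul0r add0r mulrN !mulrA pres_xz !mul0r oppr0.
  - by rewrite mulNr !mulrA -[_ * y ^+ m * y]mulrA -exprSr addNr.
move=> G f Gb GE fM fx fy fz; have [psi E] := H f fM fx fy fz; exists psi; rewrite -{}E.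
have xz := bimodule_xz Gb GE; have zy := bimodule_zy Gb GE.
have ta := bimodule_tau Gb GE.
congr (_ - _, _, _).
- have -> : (0 + X * P * X * Y ^+ m.+1) * X + (X + Y) * 0
      = X * P * ((X + Y) * Y ^+ m.+1 * X) * 1 - X * P2 * (Z * Y) * (Y ^+ m.+1 * X).
    by rewrite PE2; ncring.
  by rewrite linearB zy ta rmorph1 rmorphM mulr1 subr0.
- have -> : 0 * Z + X * - (Z * X * P * X * Y ^+ m) = - (1 * (X * Z) * (X * P * X * Y ^+ m)).
    by ncring.
  by rewrite linearN xz oppr0.
- have -> : - (Z * X * P * X * Y ^+ m) * Y + Z * (X * P * X * Y ^+ m.+1) = 0.
    by rewrite exprSr; ncring.
  by rewrite linear0.
Qed.

Lemma bracket_H1 v (P P1 P2 : F) w : v * z = 0 -> P = Z * P1 -> P = P2 * Z ->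
  resolves v (0, 0, pi P) 0 w -> hh_bracket x y z (v, 0, 0) (0, 0, pi P) w.
Proof.
move=> vz PE1 PE2; have -> : (0, 0, pi P) = (pi 0, pi 0, pi P) by rewrite rmorph0.
move=> H; apply: bracket_intro => //.
  rewrite rmorph0; congr (_, _, _) => /=.
  - by rewrite addr0 mul0r mulr0 addr0.
  - by rewrite mul0r add0r PE1 rmorphM mulrA pres_xz mul0r.
  - by rewrite mulr0 addr0 PE2 rmorphM -mulrA pres_zy mulr0.
move=> G f Gb GE fM fx fy fz; have [psi E] := H f fM fx fy fz; exists psi; rewrite -{}E.
have xz := bimodule_xz Gb GE; have zy := bimodule_zy Gb GE.
congr (_ - _, _, _).
- by rewrite addr0 mul0r mulr0 addr0 linear0.
- have -> : 0 * Z + X * P = 1 * (X * Z) * P1 by rewrite PE1; ncring.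
  by rewrite xz.
- have -> : P * Y + Z * 0 = P2 * (Z * Y) * 1 by rewrite PE2; ncring.
  by rewrite zy.
Qed.

(** * Brackets with the class A^{-2} *)

Lemma bracket_x_A1 : hh_bracket x y z (x, 0, 0) (x, y, 0) (x, 0, 0).
Proof.
apply: bracket_A1 pres_xz _ => f fM fx fy fz; exists 0.
by rewrite fx addrK; congr (_, _, _) => /=; ncring.
Qed.

Lemma bracket_x_B1 l :
  hh_bracket x y z (x, 0, 0) (y ^+ l.+1 * x, y ^+ l.+2, 0) 0.
Proof.
(* What remains is y^{l+1} x, the coboundary of y |-> y^{l+1}. *)
apply: bracket_B1 pres_xz _ => f fM fx fy fz; exists (0, y ^+ l.+1, 0).
rewrite fx tau_x; congr (_, _, _) => /=; rewrite ?pres_zyS; ncring.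
Qed.

Lemma bracket_x_C1 l : hh_bracket x y z (x, 0, 0)
  (y ^+ l.+1 * x, - (x * y ^+ l.+1), z * x * y ^+ l) 0.
Proof.
apply: bracket_C1 pres_xz _ => f fM fx fy fz; exists 0.
by rewrite fx; congr (_, _, _) => /=; ncring.
Qed.

Lemma bracket_x_D1 l j : (0 < j < l)%N -> hh_bracket x y z (x, 0, 0)
  (y ^+ l * x, - (y ^+ j * x * y ^+ (l - j)), 0) 0.
Proof.
move=> jl; apply: (bracket_D1 pres_xz jl) => f fM fx fy fz; exists 0.
have E : y ^+ j * y ^+ (l - j) = y ^+ l.
  by rewrite -exprD subnKC //; case/andP: jl => _ /ltnW.
by rewrite fx !tau_x mulrA E; congr (_, _, _) => /=; ncring.
Qed.

Lemma bracket_x_EF1 (P P1 P2 : F) m : P = Y * P1 -> P = P2 * Z ->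
  hh_bracket x y z (x, 0, 0) (0, pi P * x * y ^+ m, 0) 0.
Proof.
move=> PE1 PE2; apply: (bracket_EF1 pres_xz PE1 PE2) => f fM fx fy fz.
have Py : pi P * y = 0 by rewrite PE2 rmorphM /= -mulrA pres_zy mulr0.
have zP : z * pi P = 0 by rewrite PE1 rmorphM /= mulrA pres_zy mul0r.
(* [pi P] ends in z, so the value survives only for [m = 0], where it is [pi P * x], the coboundary
   of y |-> [pi P]. *)
exists (0, if m is 0%N then pi P else 0, 0); rewrite fx tau_x.
case: m {fx fy fz} => [|m]; congr (_, _, _) => /=; rewrite ?zP //; try ncring.
by rewrite exprS !mulrA Py; ncring.
Qed.

Lemma bracket_x_G1 (P P2 : F) m : P = P2 * Z ->
  hh_bracket x y z (x, 0, 0)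
    (0, x * pi P * x * y ^+ m.+1, - (z * x * pi P * x * y ^+ m)) 0.
Proof.
move=> PE2; apply: (bracket_G1 pres_xz PE2) => f fM fx fy fz; exists 0.
have Py : pi P * y ^+ m.+1 = 0 by rewrite PE2 rmorphM /= -mulrA pres_zyS mulr0.
rewrite fx tau_x mulrA -[x * _ * _]mulrA Py.
by congr (_, _, _) => /=; ncring.
Qed.

Lemma bracket_x_H1 (P P1 P2 : F) : P = Z * P1 -> P = P2 * Z ->
  hh_bracket x y z (x, 0, 0) (0, 0, pi P) 0.
Proof.
move=> PE1 PE2; apply: (bracket_H1 pres_xz PE1 PE2) => f fM fx fy fz; exists 0.
by rewrite fx; congr (_, _, _) => /=; ncring.
Qed.

(** * Brackets with the class of w x in terms of the derivative of the word w *)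

Section WordBrackets.
Variables (W W1 W2 : F).
Hypotheses (WE1 : W = Z * W1) (WE2 : W = W2 * Z).
Local Notation w := (pi W).

Lemma word_y : w * y = 0.
Proof. by rewrite WE2 rmorphM /= -mulrA pres_zy mulr0. Qed.

Lemma word_yS m : w * y ^+ m.+1 = 0.
Proof. by rewrite exprS mulrA word_y mul0r. Qed.

Lemma word_xx : w * x * x = 0.
Proof. by rewrite -mulrA pres_xx mulrN mulrA word_y mul0r oppr0. Qed.

Lemma wordx_z : w * x * z = 0.
Proof. by rewrite -mulrA pres_xz mulr0. Qed.

Lemma tau_wx m : tau (w * x) m.+1 = (x + y) * y ^+ m * (w * x).
Proof. exact: tau_word word_xx. Qed.

(** One has f(w x) = w f(x) + f(w) x, and w y = 0 kills the first summand in every family but A. Up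
    to coboundaries the bracket therefore depends on f(w) x alone. *)
Definition word_value (phi : A * A * A) (u : A) :=
  forall f : {linear A -> A}, derivation f ->
    f x = phi.1.1 -> f y = phi.1.2 -> f z = phi.2 -> f w * x = u.

Lemma bracket_word_A1 u : word_value (x, y, 0) (w * x - u) ->
  hh_bracket x y z (w * x, 0, 0) (x, y, 0) (u, 0, 0).
Proof.
move=> fw; apply: bracket_A1 wordx_z _ => f fM fx fy fz; exists 0.
rewrite fM (fw f fM fx fy fz) fx; congr (_, _, _) => /=; ncring.
Qed.

Lemma bracket_word_B1 l u : word_value (y ^+ l.+1 * x, y ^+ l.+2, 0) (- u) ->
  hh_bracket x y z (w * x, 0, 0) (y ^+ l.+1 * x, y ^+ l.+2, 0) (u, 0, 0).
Proof.
move=> fw; apply: bracket_B1 wordx_z _ => f fM fx fy fz.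
(* The x-value produces (x + y) y^l w x and the y-value y^{l+1} w x; the cross term vanishes by w x
   x = 0. *)
exists (y ^+ l * (w * x), y ^+ l.+1 * w, 0).
rewrite fM (fw f fM fx fy fz) fx tau_wx [w * (_ * x)]mulrA word_yS mul0r add0r opprK.
congr (_, _, _) => /=.
- have E : y ^+ l * (w * x) * x = 0 by rewrite -mulrA word_xx mulr0.
  by rewrite !mulrDl E !mulrA; abel.
- by rewrite -mulrA wordx_z; ncring.
- by rewrite mulrA pres_zyS; ncring.
Qed.

Lemma bracket_word_C1 l u :
  word_value (y ^+ l.+1 * x, - (x * y ^+ l.+1), z * x * y ^+ l) (- u) ->
  hh_bracket x y z (w * x, 0, 0)
    (y ^+ l.+1 * x, - (x * y ^+ l.+1), z * x * y ^+ l) (u, 0, 0).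
Proof.
move=> fw; apply: bracket_C1 wordx_z _ => f fM fx fy fz.
exists (0, y ^+ l.+1 * w, 0).
rewrite fM (fw f fM fx fy fz) fx [w * (_ * x)]mulrA word_yS mul0r add0r opprK.
congr (_, _, _) => /=.
- by rewrite add0r mulr0 addr0 mulrA addrC.
- by ncring.
- by rewrite mulrA pres_zyS; ncring.
Qed.

Lemma bracket_word_D1 l j : (0 < j < l)%N ->
  word_value (y ^+ l * x, - (y ^+ j * x * y ^+ (l - j)), 0) 0 ->
  hh_bracket x y z (w * x, 0, 0)
    (y ^+ l * x, - (y ^+ j * x * y ^+ (l - j)), 0) 0.
Proof.
move=> jl fw; apply: (bracket_D1 wordx_z jl) => f fM fx fy fz.
have {fw} := fw f fM fx fy fz; rewrite fM fx => ->.
case: l jl {fx fy fz} => [|l] /andP [j0 jl]; first by case: j j0 jl.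
(* With [l] lowered by one, the term y^{l+1} w x cancels the y-part of y^j (x + y) y^{l-j} w x; the
   two values account for what is left. *)
exists (y ^+ l * (w * x), - (y ^+ j * x * y ^+ (l - j) * w), 0).
rewrite (subSn (jl : (j <= l)%N)) !tau_wx [w * (_ * x)]mulrA word_yS mul0r add0r subr0.
have E : y ^+ j * y * y ^+ (l - j) = y ^+ l.+1.
  by rewrite -mulrA -exprS -exprD addnS subnKC.
congr (_, _, _) => /=.
- have E0 : y ^+ l * (w * x) * x = 0 by rewrite -mulrA word_xx mulr0.
  rewrite !(mulrDl, mulrDr, mulrN, mulNr) E0 !mulrA E -exprS.
  by abel.
- by rewrite -mulrA wordx_z; ncring.
- by rewrite mulrN !mulrA -(prednK j0) pres_zyS; ncring.
Qed.

Lemma bracket_word_EF1 (P P1 P2 : F) m u : P = Y * P1 -> P = P2 * Z ->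
  word_value (0, pi P * x * y ^+ m, 0) (- u) ->
  hh_bracket x y z (w * x, 0, 0) (0, pi P * x * y ^+ m, 0) (u, 0, 0).
Proof.
move=> PE1 PE2 fw; apply: (bracket_EF1 wordx_z PE1 PE2) => f fM fx fy fz.
rewrite fM (fw f fM fx fy fz) fx mulr0 add0r opprK.
have Py : pi P * y = 0 by rewrite PE2 rmorphM /= -mulrA pres_zy mulr0.
have zP : z * pi P = 0 by rewrite PE1 rmorphM /= mulrA pres_zy mul0r.
(* [tau] carries a factor x + y only for positive exponents, hence two witnesses; after [pi P] the
   y-part of that factor is 0. *)
exists (0, if m is m'.+1 then pi P * x * y ^+ m' * w else pi P * w, 0).
case: m {fw fx fy fz} => [|m]; rewrite ?tau_wx; congr (_, _, _) => /=;
  rewrite ?(mul0r, mulr0, add0r, addr0) ?mulrA ?zP ?mul0r //.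
  by rewrite addrC.
by rewrite mulrDr Py addr0 addrC.
Qed.

Lemma bracket_word_G1 (P P2 : F) m u : P = P2 * Z ->
  word_value (0, x * pi P * x * y ^+ m.+1, - (z * x * pi P * x * y ^+ m)) (- u) ->
  hh_bracket x y z (w * x, 0, 0)
    (0, x * pi P * x * y ^+ m.+1, - (z * x * pi P * x * y ^+ m)) (u, 0, 0).
Proof.
move=> PE2 fw; apply: (bracket_G1 wordx_z PE2) => f fM fx fy fz.
rewrite fM (fw f fM fx fy fz) fx mulr0 add0r opprK tau_wx.
have Py : pi P * y = 0 by rewrite PE2 rmorphM /= -mulrA pres_zy mulr0.
(* The choice y |-> x P x y^m w would spoil the third component, since z need not kill it. The
   target comes instead from (x + y) P x y^m w x, its y-part being removed by a y-value that z does
   kill. *)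
exists (pi P * x * y ^+ m * (w * x), - (y * pi P * x * y ^+ m * w), 0).
congr (_, _, _) => /=.
- have E0 : pi P * x * y ^+ m * (w * x) * x = 0 by rewrite -mulrA word_xx mulr0.
  rewrite !(mulrDl, mulrDr, mulNr) E0 !mulrA -[x * pi P * y]mulrA Py.
  by ncring.
- by rewrite -mulrA wordx_z; ncring.
- by rewrite mulrN !mulrA pres_zy; ncring.
Qed.

Lemma bracket_word_H1 (P P1 P2 : F) u : P = Z * P1 -> P = P2 * Z ->
  word_value (0, 0, pi P) (- u) ->
  hh_bracket x y z (w * x, 0, 0) (0, 0, pi P) (u, 0, 0).
Proof.
move=> PE1 PE2 fw; apply: (bracket_H1 wordx_z PE1 PE2) => f fM fx fy fz; exists 0.
rewrite fM (fw f fM fx fy fz) fx; congr (_, _, _) => /=; ncring.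
Qed.

End WordBrackets.

(** * Derivatives of words as sums of basis symbols *)

Local Notation wd := (gword x y z).

Lemma pi_gword ns ms : pi (gword X Y Z ns ms) = wd ns ms.
Proof.
rewrite !gwordE rmorphM rmorphXn rmorph_prod; congr (_ * _).
by apply: eq_bigr => nm _; rewrite !rmorphM !rmorphXn.
Qed.

Lemma gword_frame ns ms : size ms = (size ns).+1 -> all (ltn 0) ms ->
  exists W1 W2, gword X Y Z ns ms = Z * W1 /\ gword X Y Z ns ms = W2 * Z.
Proof.
move=> sz ms0; have [W1 E1] : exists t, gword X Y Z ns ms = Z * t.
  by apply: gword_head; rewrite ?sz.
by have [W2 E2] := gword_last X Y Z sz ms0; exists W1, W2.
Qed.

Definition wordx ns ms : A :=
  if all (ltn 0%N) ns && all (ltn 0%N) ms then wd ns ms * x else 0.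

Section Sums.
Variables (n m : nat -> nat) (p : nat).
Hypotheses (p0 : (0 < p)%N) (n0 : forall i, (0 < n i)%N) (m0 : forall i, (0 < m i)%N).
Local Notation W := (wd (seg n 2 p) (seg m 1 p)).

(** The two halves of the word cut inside its i-th z-block, with [a] and [b] letters z on the two
    sides of the cut. *)
Local Notation L i a := (wd (seg n 2 i) (rcons (seg m 1 i.-1) a)).
Local Notation R i b := (wd (seg n i.+1 p) (b :: seg m i.+1 p)).

Lemma size_left i : (0 < i)%N -> size (seg n 2 i) = size (seg m 1 i.-1).
Proof. by move=> i0; rewrite !size_seg; lia. Qed.

Lemma left_exp i a b : (0 < i)%N -> L i a * z ^+ b = L i (a + b)%N.
Proof. by move=> i0; rewrite gword_expr ?size_left. Qed.

Lemma left_z i a : (0 < i)%N -> L i a * z = L i a.+1.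
Proof. by move=> i0; rewrite -[X in _ * X]expr1 left_exp // addn1. Qed.

Lemma right_exp i a b : z ^+ a * R i b = R i (a + b)%N.
Proof. exact: gword_expl. Qed.

Lemma x_right i b : (0 < b)%N -> x * R i b = 0.
Proof. by case: b => // b _; rewrite -(add1n b) -right_exp expr1 mulrA pres_xz mul0r. Qed.

Lemma right0_x i : exists t, R i 0 * x = x * t.
Proof. by apply: gword0_x; rewrite !size_seg. Qed.

(** With no z left, the right half times the final x starts with x, and z x y^l x = 0. This makes
    the sum for C stop at m_i - 1; the last term for G dies in the same way. *)
Lemma left_xy_right0 i a l : (0 < i)%N -> L i a.+1 * (x * y ^+ l) * (R i 0 * x) = 0.
Proof.
move=> i0; have [t ->] := right0_x i.
rewrite -left_z // mulrA -[_ * z * _]mulrA -[_ * (z * _) * x]mulrA (mulrA z).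
by rewrite pres_zxyx mulr0 mul0r.
Qed.

Lemma left_word i : (1 < i)%N -> exists t, wd (seg n 2 i.-1) (seg m 1 i.-1) = t * z.
Proof.
by move=> i1; apply: gword_last; [rewrite !size_seg; lia|exact: all_seg].
Qed.

Lemma x_right_word i : (i <= p)%N -> x * wd (seg n i.+1 p) (seg m i p) = 0.
Proof.
move=> ip; have [|t ->] := gword_head x y z (seg n i.+1 p) _ (all_seg i p m0).
  by rewrite size_seg; lia.
by rewrite mulrA pres_xz mul0r.
Qed.

Variable f : {linear A -> A}.
Hypothesis fM : derivation f.

(** Every block x y^{n_i} is preceded by a z, so the hypothesis removes its derivative. *)
Lemma derivation_word_z : (forall j, z * f (x * y ^+ j) = 0) ->
  f W = \sum_(1 <= i < p.+1) \sum_(0 <= j < m i) L i j * f z * R i (m i - j.+1)%N.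
Proof.
move=> zf; rewrite gword_derivation // [X in _ + X]big1_seq ?addr0; last first.
  move=> i /andP [_]; rewrite mem_index_iota => /andP [i1 _].
  by have [t ->] := left_word i1; rewrite -[_ * f _]mulrA zf mulr0 mul0r.
apply: eq_big_nat => i /andP [i1 _].
rewrite (derivation_expr fM) mulr_sumr mulr_suml; apply: eq_big_nat => j _.
rewrite !mulrA left_exp // -[LHS]mulrA right_exp add0n addn0.
by [].
Qed.

Lemma derivation_word_x : f z = 0 ->
  f W = \sum_(2 <= i < p.+1) wd (seg n 2 i.-1) (seg m 1 i.-1) * f (x * y ^+ n i)
          * wd (seg n i.+1 p) (seg m i p).
Proof.
move=> fz; rewrite gword_derivation // big1_seq ?add0r // => i _.
rewrite (derivation_expr fM) big1 ?mulr0 ?mul0r // => j _.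
by rewrite fz mulr0 mul0r.
Qed.

Lemma derivation_xy0 : z * f x = 0 -> (forall j, z * x * y ^+ j * f y = 0) ->
  forall j, z * f (x * y ^+ j) = 0.
Proof.
move=> zfx zfy j; rewrite fM mulrDr (mulrA _ (f x)) zfx mul0r addr0 mulrA.
rewrite (derivation_expr fM) mulr_sumr big1 // => i _.
by rewrite !mulrA zfy mul0r.
Qed.

Lemma word_insert_x i e : (1 < i <= p)%N ->
  wd (seg n 2 i.-1) (seg m 1 i.-1) * (x * y ^+ e) * wd (seg n i.+1 p) (seg m i p)
    = wd (seg n 2 i.-1 ++ e :: seg n i.+1 p) (seg m 1 p).
Proof.
case/andP=> i1 ip; rewrite gword_cat ?size_seg; [|lia|lia].
by congr (wd _ _); rewrite -{2}(prednK (ltnW i1)) -seg_cat //; lia.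
Qed.

(** Each of the p - 1 blocks x y^{n_i} has weight n_i + 1. In the bracket 2 w x - f(w x) the final x
    of w x accounts for one more, which gives p - 2. *)
Lemma derivation_A : f x = x -> f y = y -> f z = 0 ->
  f W = ((\sum_(2 <= i < p.+1) n i)%N + p.-1)%:R *: W.
Proof.
move=> fx fy fz; rewrite derivation_word_x //.
transitivity (\sum_(2 <= i < p.+1) ((n i)%:R + 1) *: W); last first.
  rewrite -scaler_suml big_split /= -natr_sum natrD; congr ((_ + _) *: _).
  by rewrite big_const_nat iter_addr_0; congr (_%:R); lia.
apply: eq_big_nat => i ip.
have fxy : f (x * y ^+ n i) = ((n i)%:R + 1) *: (x * y ^+ n i).
  rewrite fM fx (derivation_expr fM) scalerDl scale1r; congr (_ + _).
  rewrite (eq_big_nat _ _ (F2 := fun=> y ^+ n i)) => [|j /andP [_ jn]].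
    by rewrite big_const_nat iter_addr_0 subn0 mulrnAr scaler_nat.
  by rewrite fy -exprSr -exprD; congr (_ ^+ _); lia.
rewrite fxy -scalerAr -scalerAl word_insert_x //; congr (_ *: wd _ _).
case/andP: ip => i1 ip; rewrite -(seg_cons n) //.
by rewrite -{2}(prednK (ltnW i1)) -seg_cat //; lia.
Qed.

Lemma derivation_B l : f x = y ^+ l.+1 * x -> f y = y ^+ l.+2 -> f z = 0 ->
  f W * x = \sum_(2 <= i < p.+1)
    (n i)%:R *: wordx (seg n 2 i.-1 ++ (n i + l.+1)%N :: seg n i.+1 p) (seg m 1 p).
Proof.
move=> fx fy fz; rewrite derivation_word_x // mulr_suml; apply: eq_big_nat => i ip.
have [i1 ip'] := andP ip; have [t tE] := left_word i1.
rewrite /wordx all_cat /= !all_seg //= addnS /= scalerAl; congr (_ * x).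
(* The preceding z kills y^{l+1} x y^{n_i}, and the other n_i summands coincide. *)
have E : z * f (x * y ^+ n i) = (n i)%:R *: (z * (x * y ^+ (n i + l).+1)).
  rewrite fM fx (derivation_expr fM) mulrDr !mulrA pres_zyS !mul0r addr0.
  rewrite (eq_big_nat _ _ (F2 := fun=> y ^+ (n i + l).+1)) => [|j /andP [_ jn]].
    by rewrite big_const_nat iter_addr_0 subn0 mulrnAr scaler_nat.
  by rewrite fy -!exprD; congr (_ ^+ _); lia.
by rewrite -word_insert_x // tE -[t * z * f _]mulrA E -scalerAr -scalerAl !mulrA.
Qed.

Lemma derivation_C l : z * f x = 0 -> (forall j, z * x * y ^+ j * f y = 0) ->
  f z = z * (x * y ^+ l) ->
  f W * x = \sum_(1 <= i < p.+1) \sum_(1 <= j < m i)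
    wordx (seg n 2 i ++ l :: seg n i.+1 p)
          (seg m 1 i.-1 ++ j :: (m i - j)%N :: seg m i.+1 p).
Proof.
move=> zfx zfy fz; rewrite derivation_word_z; last exact: derivation_xy0.
rewrite mulr_suml; apply: eq_big_nat => i /andP [i1 _].
pose T j := L i j * (x * y ^+ l) * R i (m i - j)%N * x.
(* [f z] brings its own z, so the j-th summand has j + 1 letters z on the left; after re-indexing,
   the last term vanishes. *)
rewrite mulr_suml (eq_big_nat _ _ (F2 := fun j => T j.+1)) => [|j _]; last first.
  by rewrite /T fz [_ * (z * _)]mulrA left_z.
rewrite -(big_add1 _ _ 0 (m i).+1 xpredT) big_nat_recr ?m0 //=.
rewrite [T (m i)](_ : _ = 0) ?addr0; last first.
  by rewrite /T subnn -(prednK (m0 i)) -mulrA left_xy_right0.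
apply: eq_big_nat => j /andP [j0 jm].
have mj : (0 < m i - j)%N by lia.
rewrite /wordx !all_cat /= !all_seg // j0 mj !andbT /=.
(* For [l = 0] the inserted x meets z^{m_i - j} and gives 0, in agreement with the zero entry of the
   symbol. *)
case: l @T {fz} => [|l] T /=; last by rewrite /T gword_join // size_left.
by rewrite /T expr0 mulr1 -2!mulrA (mulrA x) x_right // mul0r mulr0.
Qed.

Section Inserted.
Variables (r u : nat -> nat) (q : nat).
Hypotheses (q0 : (0 < q)%N) (r0 : forall i, (0 < r i)%N) (u0 : forall i, (0 < u i)%N).
Local Notation V := (wd (seg r 2 q) (seg u 1 q)).

Lemma inserted_frame : exists t1 t2, V = z * t1 /\ V = t2 * z.
Proof.
have [t1 E1] : exists t, V = z * t.
  by apply: gword_head; [rewrite size_seg; lia|exact: all_seg].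
have [t2 E2] : exists t, V = t * z.
  by apply: gword_last; [rewrite !size_seg; lia|exact: all_seg].
by exists t1, t2.
Qed.

Lemma derivation_G l : z * f x = 0 -> (forall j, z * x * y ^+ j * f y = 0) ->
  f z = - (z * (x * y ^+ r 1) * V * (x * y ^+ l)) ->
  f W * x = - \sum_(1 <= i < p.+1) \sum_(1 <= j < m i)
    wordx (seg n 2 i ++ seg r 1 q ++ l :: seg n i.+1 p)
          (seg m 1 i.-1 ++ j :: seg u 1 q ++ (m i - j)%N :: seg m i.+1 p).
Proof.
move=> zfx zfy fz; rewrite derivation_word_z; last exact: derivation_xy0.
rewrite mulr_suml -sumrN; apply: eq_big_nat => i /andP [i1 _].
pose T j := L i j * (x * y ^+ r 1) * V * (x * y ^+ l) * R i (m i - j)%N * x.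
rewrite mulr_suml (eq_big_nat _ _ (F2 := fun j => - T j.+1)) => [|j _]; last first.
  by rewrite /T fz mulrN !mulNr -left_z // !mulrA.
rewrite sumrN; congr (- _).
rewrite -(big_add1 _ _ 0 (m i).+1 xpredT) big_nat_recr ?m0 //=.
have [t1 [t2 [VE1 VE2]]] := inserted_frame.
(* Here the z in z x y^l x = 0 is the last letter of [V]. *)
rewrite [T (m i)](_ : _ = 0) ?addr0; last first.
  have [t tE] := right0_x i.
  rewrite /T subnn -mulrA tE VE2 !mulrA -[_ * z * x]mulrA -[_ * (z * x) * _]mulrA.
  by rewrite -[_ * (z * x * _) * x]mulrA pres_zxyx mulr0 mul0r.
apply: eq_big_nat => j /andP [j0 jm].
have mj : (0 < m i - j)%N by lia.
rewrite /wordx !all_cat /= !all_cat /= !all_seg // j0 mj !andbT /=.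
case: l @T {fz} => [|l] T /=; last first.
  rewrite /T gword_cat ?size_rcons ?size_left ?size_seg //; last by lia.
  rewrite gword_cat ?size_cat ?size_rcons /= ?size_seg; [|lia|by []].
  by rewrite (seg_cons r q0) -cats1 -!catA.
by rewrite /T expr0 mulr1 -2!mulrA (mulrA x) x_right // mul0r mulr0.
Qed.

Lemma derivation_F l : f x = 0 -> f y = y ^+ r 1 * V * (x * y ^+ l) -> f z = 0 ->
  f W * x = \sum_(2 <= i < p.+1) \sum_(0 <= j < n i)
    wordx (seg n 2 i.-1 ++ (r 1 + j)%N :: seg r 2 q
             ++ (l.+1 + n i - j - 2)%N :: seg n i.+1 p)
          (seg m 1 i.-1 ++ seg u 1 q ++ seg m i p).
Proof.
move=> fx fy fz; rewrite derivation_word_x // mulr_suml; apply: eq_big_nat => i /andP [i1 ip].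
rewrite fM fx mul0r addr0 (derivation_expr fM) !mulr_sumr !mulr_suml.
apply: eq_big_nat => j /andP [_ jn].
rewrite /wordx !all_cat /= !all_cat /= !all_seg // !andbT /= addn_gt0 r0 /=.
have -> : wd (seg n 2 i.-1) (seg m 1 i.-1) * (x * (y ^+ j * f y * y ^+ (n i - j.+1))) =
    wd (seg n 2 i.-1) (seg m 1 i.-1) * (x * y ^+ (r 1 + j)) * V
      * (x * y ^+ (l.+1 + n i - j - 2)).
  have -> : (l.+1 + n i - j - 2 = l + (n i - j.+1))%N by lia.
  by rewrite fy addnC !exprD !mulrA.
(* The exponent is 0 exactly for [l = 0] and [j = n i - 1]. The x then meets the z that begins the
   right part, and the symbol has a zero entry. *)
case: posnP => [->|e0].
  rewrite expr0 mulr1 -[_ * x * _]mulrA x_right_word ?mulr0 ?mul0r //.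
rewrite gword_cat ?size_seg; [|lia|lia].
rewrite gword_cat ?size_cat /= ?size_seg; [|lia|lia].
by rewrite -!catA.
Qed.

(** Replacing any one of the m_i letters z by z^{u_1} gives the same word, hence the coefficient. *)
Lemma derivation_H1 : q = 1%N -> f x = 0 -> f y = 0 -> f z = V ->
  f W * x = \sum_(1 <= i < p.+1)
    (m i)%:R *: wordx (seg n 2 p) (seg m 1 i.-1 ++ (u 1 + m i - 1)%N :: seg m i.+1 p).
Proof.
move=> q1 fx fy fz; rewrite derivation_word_z; last first.
  by apply: derivation_xy0 => [|j]; rewrite ?fx ?fy mulr0.
rewrite mulr_suml; apply: eq_big_nat => i /andP [i1 ip].
have VE : V = z ^+ u 1 by rewrite q1 -[seg r 2 1]/[::] -[seg u 1 1]/[:: u 1] gword1.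
have sm : (0 < u 1 + m i - 1)%N by have := u0 1; have := m0 i; lia.
rewrite /wordx !all_cat /= !all_seg //= sm /= scalerAl; congr (_ * x).
rewrite (eq_big_nat _ _ (F2 := fun=> wd (seg n 2 p)
    (seg m 1 i.-1 ++ (u 1 + m i - 1)%N :: seg m i.+1 p))) => [|j /andP [_ jm]].
  by rewrite big_const_nat iter_addr_0 subn0 scaler_nat.
rewrite fz VE left_exp // gword_merge ?size_left // -seg_cat //.
by congr (wd _ (_ ++ _ :: _)); lia.
Qed.

(** For q > 1 the two ends of the inserted word fuse with different z-powers, so the position [j]
    stays visible in the exponents, and both of these are positive. *)
Lemma derivation_H2 : (1 < q)%N -> f x = 0 -> f y = 0 -> f z = V ->
  f W * x = \sum_(1 <= i < p.+1) \sum_(0 <= j < m i)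
    wordx (seg n 2 i ++ seg r 2 q ++ seg n i.+1 p)
      (seg m 1 i.-1 ++ (j + u 1)%N :: seg u 2 q.-1
         ++ (u q + m i - j - 1)%N :: seg m i.+1 p).
Proof.
move=> q1 fx fy fz; rewrite derivation_word_z; last first.
  by apply: derivation_xy0 => [|j]; rewrite ?fx ?fy mulr0.
rewrite mulr_suml; apply: eq_big_nat => i /andP [i1 ip].
rewrite mulr_suml; apply: eq_big_nat => j /andP [_ jm].
have e0 : (0 < u q + m i - j - 1)%N by have := u0 q; lia.
rewrite /wordx !all_cat /= !all_cat /= !all_seg // addn_gt0 u0 orbT e0 /=.
have VE : V = wd (seg r 2 q) (u 1 :: rcons (seg u 2 q.-1) (u q)).
  congr (wd _ _); rewrite (seg_cons u q0); congr (_ :: _).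
  by have := @seg_rcons u 2 q.-1; rewrite (prednK q0) => ->.
rewrite fz VE gword_merge ?size_left // -rcons_cons -rcons_cat gword_merge; last first.
  by rewrite !size_cat /= !size_seg; lia.
rewrite -!catA /=; congr (wd _ (_ ++ _ :: _ ++ _ :: _) * x); lia.
Qed.

End Inserted.
End Sums.

(** * The bracket formulas over an abstract presentation *)

Lemma gB2E ns ms : (if all (ltn 0%N) ns && all (ltn 0%N) ms
  then (xyzword x y z ns ms * x, 0, 0) else 0 : A * A * A) = (wordx ns ms, 0, 0).
Proof. by rewrite /wordx gwordE; case: ifP. Qed.

Lemma triple_sum (I : Type) (l : seq I) (P : pred I) (h : I -> A) :
  \sum_(i <- l | P i) ((h i, 0, 0) : A * A * A) = (\sum_(i <- l | P i) h i, 0, 0).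
Proof.
elim: l => [|i l IH]; rewrite ?big_nil // !big_cons; case: (P i); rewrite // IH.
by congr (_, _, _); rewrite /= addr0.
Qed.

Lemma tripleN (a : A) : - ((a, 0, 0) : A * A * A) = (- a, 0, 0).
Proof. by congr (_, _, _); rewrite /= oppr0. Qed.

Lemma tripleZ c (a : A) : c *: ((a, 0, 0) : A * A * A) = (c *: a, 0, 0).
Proof. by congr (_, _, _); rewrite /= scaler0. Qed.

Local Notation gB2 ns ms := (if all (ltn 0%N) ns && all (ltn 0%N) ms
  then (xyzword x y z ns ms * x, 0, 0) else 0 : A * A * A).

Section Words.
Variables (n m : nat -> nat) (p : nat).
Hypotheses (p0 : (0 < p)%N) (n0 : forall i, (0 < n i)%N) (m0 : forall i, (0 < m i)%N).
Local Notation B := (gB2 (seg n 2 p) (seg m 1 p)).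
Local Notation w := (gword x y z (seg n 2 p) (seg m 1 p)).

Lemma hh_word_frame : exists W W1 W2, [/\ W = Z * W1, W = W2 * Z, pi W = w &
  B = (pi W * x, 0, 0)].
Proof.
have [|t1 [t2 [E1 E2]]] := gword_frame (ns := seg n 2 p) (ms := seg m 1 p) _ (all_seg 1 p m0).
  by rewrite !size_seg; lia.
exists (gword X Y Z (seg n 2 p) (seg m 1 p)), t1, t2; split=> //; first exact: pi_gword.
by rewrite gB2E pi_gword /wordx !all_seg.
Qed.

Lemma hh_word_A : hh_bracket x y z B (x, y, 0)
  (- (((\sum_(2 <= i < p.+1) n i)%N%:R + p%:R - 2%:R) *: B)).
Proof.
have [W [W1 [W2 [E1 E2 EW ->]]]] := hh_word_frame.
rewrite tripleZ tripleN; apply: bracket_word_A1 => f fM /= fx fy fz.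
rewrite EW (derivation_A n m p0 fM fx fy fz) opprK -scalerAl natrD.
have -> : p%:R = p.-1%:R + 1 :> k by rewrite -[in LHS](prednK p0) -addn1 natrD.
rewrite -[X in _ = X + _]scale1r -scalerDl; congr (_ *: _).
by rewrite -[2%:R]/(1 + 1 : k); abel.
Qed.

Lemma hh_word_B l : hh_bracket x y z B (y ^+ l.+1 * x, y ^+ l.+2, 0)
  (- \sum_(2 <= i < p.+1) (n i)%:R *:
      gB2 (seg n 2 i.-1 ++ [:: (n i + l.+1)%N] ++ seg n i.+1 p) (seg m 1 p)).
Proof.
have [W [W1 [W2 [E1 E2 EW ->]]]] := hh_word_frame.
rewrite (eq_bigr _ (fun i _ => etrans (congr1 _ (gB2E _ _)) (tripleZ _ _))).
rewrite triple_sum tripleN; apply: (bracket_word_B1 E2) => f fM /= fx fy fz.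
by rewrite opprK EW (derivation_B p0 n0 m0 fM fx fy fz).
Qed.

Lemma hh_word_C l : hh_bracket x y z B
    (y ^+ l.+1 * x, - (x * y ^+ l.+1), z * x * y ^+ l)
  (- \sum_(1 <= i < p.+1) \sum_(1 <= j < m i)
      gB2 (seg n 2 i ++ [:: l] ++ seg n i.+1 p)
        (seg m 1 i.-1 ++ [:: j; (m i - j)%N] ++ seg m i.+1 p)).
Proof.
have [W [W1 [W2 [E1 E2 EW ->]]]] := hh_word_frame.
rewrite (eq_bigr _ (fun i _ => etrans (eq_bigr _ (fun j _ => gB2E _ _)) (triple_sum _ _ _))).
rewrite triple_sum tripleN; apply: (bracket_word_C1 E2) => f fM /= fx fy fz.
rewrite opprK EW; apply: (derivation_C p0 n0 m0 fM) => [|j|].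
- by rewrite fx mulrA pres_zyS mul0r.
- by rewrite fy mulrN mulrA pres_zxyx mul0r oppr0.
- by rewrite fz mulrA.
Qed.

Lemma hh_word_D l j : (0 < j < l)%N ->
  hh_bracket x y z B (y ^+ l * x, - (y ^+ j * x * y ^+ (l - j)), 0) 0.
Proof.
have [W [W1 [W2 [E1 E2 EW ->]]]] := hh_word_frame.
move=> jl; apply: (bracket_word_D1 E2 jl) => f fM /= fx fy fz.
(* The derivative of the word vanishes: z kills y^l x, and z x y^i y^j x = 0. *)
rewrite EW derivation_word_z //; first
  by rewrite fz !big1 ?mul0r // => i _;
  rewrite big1 // => t _; rewrite mulr0 mul0r.
case/andP: jl => j0 jl; apply: derivation_xy0 => // [|i].
  by rewrite fx mulrA -(prednK (ltn_trans j0 jl)) pres_zyS mul0r.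
by rewrite fy mulrN !mulrA -[_ * y ^+ i * y ^+ j]mulrA -exprD pres_zxyx mul0r oppr0.
Qed.

End Words.

Section Frames.
Variables (r u : nat -> nat) (q : nat).
Hypotheses (q0 : (0 < q)%N) (r0 : forall i, (0 < r i)%N) (u0 : forall i, (0 < u i)%N).
Local Notation V := (xyzword x y z (seg r 2 q) (seg u 1 q)).

(** The abstract brackets need a preimage in the free algebra with visible outer letters, since that
    is where the relations XZ and ZY are exhibited. *)
Lemma frame_H : exists P P1 P2, [/\ P = Z * P1, P = P2 * Z & pi P = V].
Proof.
have [|t1 [t2 [E1 E2]]] := gword_frame (ns := seg r 2 q) (ms := seg u 1 q) _ (all_seg 1 q u0).
  by rewrite !size_seg; lia.
by exists (gword X Y Z (seg r 2 q) (seg u 1 q)), t1, t2; split=> //; rewrite pi_gword gwordE.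
Qed.

Lemma frame_F : exists P P1 P2, [/\ P = Y * P1, P = P2 * Z & pi P = y ^+ r 1 * V].
Proof.
have [P [P1 [P2 [E1 E2 <-]]]] := frame_H.
exists (Y ^+ r 1 * P), (Y ^+ (r 1).-1 * P), (Y ^+ r 1 * P2).
split; first by rewrite mulrA -exprS prednK.
  by rewrite E2 mulrA.
by rewrite rmorphM rmorphXn.
Qed.

Lemma frame_E : exists P P1 P2,
  [/\ P = Y * P1, P = P2 * Z & pi P = y ^+ r 0 * x * y ^+ r 1 * V].
Proof.
have [P [P1 [P2 [E1 E2 EV]]]] := frame_F.
exists (Y ^+ r 0 * X * P), (Y ^+ (r 0).-1 * X * P), (Y ^+ r 0 * X * P2).
split; first by rewrite !mulrA -exprS prednK.
  by rewrite E2 !mulrA.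
by rewrite !rmorphM rmorphXn /= EV !mulrA.
Qed.

Lemma hh_x_E : hh_bracket x y z (x, 0, 0)
  (0, y ^+ r 0 * x * y ^+ r 1 * V * x * y ^+ (r q.+1).-1, 0) 0.
Proof.
by have [P [P1 [P2 [E1 E2 <-]]]] := frame_E; apply: bracket_x_EF1 E1 E2.
Qed.

Lemma hh_x_F : hh_bracket x y z (x, 0, 0)
  (0, y ^+ r 1 * V * x * y ^+ (r q.+1).-1, 0) 0.
Proof.
by have [P [P1 [P2 [E1 E2 <-]]]] := frame_F; apply: bracket_x_EF1 E1 E2.
Qed.

Lemma hh_x_G : hh_bracket x y z (x, 0, 0)
  (0, x * y ^+ r 1 * V * x * y ^+ r q.+1,
   - (z * x * y ^+ r 1 * V * x * y ^+ (r q.+1).-1)) 0.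
Proof.
have [P [P1 [P2 [E1 E2 EV]]]] := frame_F.
rewrite -(prednK (r0 q.+1)) -[x * _ * V]mulrA -[_ * _ * V]mulrA -EV.
exact: bracket_x_G1 E2.
Qed.

Lemma hh_x_H : hh_bracket x y z (x, 0, 0) (0, 0, V) 0.
Proof.
by have [P [P1 [P2 [E1 E2 <-]]]] := frame_H; apply: bracket_x_H1 E1 E2.
Qed.

Section WordFrames.
Variables (n m : nat -> nat) (p : nat).
Hypotheses (p0 : (0 < p)%N) (n0 : forall i, (0 < n i)%N) (m0 : forall i, (0 < m i)%N).
Local Notation B := (gB2 (seg n 2 p) (seg m 1 p)).
Local Notation w := (gword x y z (seg n 2 p) (seg m 1 p)).

Lemma hh_word_E : hh_bracket x y z B
  (0, y ^+ r 0 * x * y ^+ r 1 * V * x * y ^+ (r q.+1).-1, 0) 0.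
Proof.
have [W [W1 [W2 [E1 E2 EW ->]]]] := hh_word_frame p0 n0 m0.
have [P [P1 [P2 [PE1 PE2 PV]]]] := frame_E; rewrite -PV.
apply: (bracket_word_EF1 E2 PE1 PE2) => f fM /= fx fy fz.
rewrite oppr0 EW derivation_word_z //; first
  by rewrite fz !big1 ?mul0r // => i _;
  rewrite big1 // => t _; rewrite mulr0 mul0r.
apply: derivation_xy0 => // [|i]; first by rewrite fx mulr0.
(* After z x y^i the leading y^{r_0} x of [f y] gives z x y^{i + r_0} x = 0; the family F lacks this
   prefix and has a nonzero formula. *)
by rewrite fy PV !mulrA -[_ * y ^+ i * y ^+ r 0]mulrA -exprD pres_zxyx !mul0r.
Qed.

Lemma hh_word_F : hh_bracket x y z B (0, y ^+ r 1 * V * x * y ^+ (r q.+1).-1, 0)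
  (- \sum_(2 <= i < p.+1) \sum_(0 <= j < n i)
      gB2 (seg n 2 i.-1 ++ [:: (r 1 + j)%N] ++ seg r 2 q
             ++ [:: (r q.+1 + n i - j - 2)%N] ++ seg n i.+1 p)
          (seg m 1 i.-1 ++ seg u 1 q ++ seg m i p)).
Proof.
have [W [W1 [W2 [E1 E2 EW ->]]]] := hh_word_frame p0 n0 m0.
have [P [P1 [P2 [PE1 PE2 PV]]]] := frame_F; rewrite -PV.
rewrite (eq_bigr _ (fun i _ => etrans (eq_bigr _ (fun j _ => gB2E _ _)) (triple_sum _ _ _))).
rewrite triple_sum tripleN; apply: (bracket_word_EF1 E2 PE1 PE2) => f fM /= fx fy fz.
rewrite opprK EW -(prednK (r0 q.+1)); apply: (derivation_F p0 n0 m0 fM q0 r0 u0 fx _ fz).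
by rewrite fy PV gwordE mulrA.
Qed.

Lemma hh_word_G : hh_bracket x y z B
  (0, x * y ^+ r 1 * V * x * y ^+ r q.+1,
   - (z * x * y ^+ r 1 * V * x * y ^+ (r q.+1).-1))
  (\sum_(1 <= i < p.+1) \sum_(1 <= j < m i)
      gB2 (seg n 2 i ++ seg r 1 q ++ [:: (r q.+1).-1] ++ seg n i.+1 p)
          (seg m 1 i.-1 ++ [:: j] ++ seg u 1 q ++ [:: (m i - j)%N] ++ seg m i.+1 p)).
Proof.
have [W [W1 [W2 [E1 E2 EW ->]]]] := hh_word_frame p0 n0 m0.
have [P [P1 [P2 [PE1 PE2 PV]]]] := frame_F.
rewrite -(prednK (r0 q.+1)) -[x * _ * V]mulrA -[_ * _ * V]mulrA -PV.
rewrite (eq_bigr _ (fun i _ => etrans (eq_bigr _ (fun j _ => gB2E _ _)) (triple_sum _ _ _))).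
rewrite triple_sum; apply: (bracket_word_G1 E2 PE2) => f fM /= fx fy fz.
rewrite EW; apply: (derivation_G p0 n0 m0 fM q0 r0 u0) => [|j|].
- by rewrite fx mulr0.
- by rewrite fy !mulrA pres_zxyx !mul0r.
- by rewrite fz PV gwordE !mulrA.
Qed.

Lemma hh_word_H1 : q = 1%N -> hh_bracket x y z B (0, 0, V)
  (- \sum_(1 <= i < p.+1) (m i)%:R *:
      gB2 (seg n 2 p) (seg m 1 i.-1 ++ [:: (u 1 + m i - 1)%N] ++ seg m i.+1 p)).
Proof.
have [W [W1 [W2 [E1 E2 EW ->]]]] := hh_word_frame p0 n0 m0.
have [P [P1 [P2 [PE1 PE2 PV]]]] := frame_H; rewrite -PV => q1.
rewrite (eq_bigr _ (fun i _ => etrans (congr1 _ (gB2E _ _)) (tripleZ _ _))).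
rewrite triple_sum tripleN; apply: (bracket_word_H1 PE1 PE2) => f fM /= fx fy fz.
rewrite opprK EW; apply: (derivation_H1 (r := r) p0 n0 m0 fM q0 u0 q1 fx fy).
by rewrite fz PV gwordE.
Qed.

Lemma hh_word_H2 : (1 < q)%N -> hh_bracket x y z B (0, 0, V)
  (- \sum_(1 <= i < p.+1) \sum_(0 <= j < m i)
      gB2 (seg n 2 i ++ seg r 2 q ++ seg n i.+1 p)
          (seg m 1 i.-1 ++ [:: (j + u 1)%N] ++ seg u 2 q.-1
             ++ [:: (u q + m i - j - 1)%N] ++ seg m i.+1 p)).
Proof.
have [W [W1 [W2 [E1 E2 EW ->]]]] := hh_word_frame p0 n0 m0.
have [P [P1 [P2 [PE1 PE2 PV]]]] := frame_H; rewrite -PV => q1.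
rewrite (eq_bigr _ (fun i _ => etrans (eq_bigr _ (fun j _ => gB2E _ _)) (triple_sum _ _ _))).
rewrite triple_sum tripleN; apply: (bracket_word_H1 PE1 PE2) => f fM /= fx fy fz.
rewrite opprK EW; apply: (derivation_H2 p0 n0 m0 fM q0 r0 u0 q1 fx fy).
by rewrite fz PV gwordE.
Qed.

End WordFrames.
End Frames.

End Presentation.

(** * The presentation of the concrete algebra *)

Section Instance.
Variable k : fieldType.
Local Notation F := {malg k[{fmonom 'I_3}]}.

Lemma gen_ind (P : F -> Prop) :
  (forall c p q, P p -> P q -> P (c *: p + q)) -> P 1 ->
  (forall p, P p -> P (X k * p)) -> (forall p, P p -> P (Y k * p)) ->
  (forall p, P p -> P (Z k * p)) -> forall p, P p.
Proof.
move=> PD P1 PX PY PZ; refine (free_ind PD P1 _).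
case=> [[|[|[|j]]] lti] p Pp; last by [].
- by rewrite (_ : Ordinal lti = @Ordinal 3 0 isT); [exact: PX|exact/val_inj].
- by rewrite (_ : Ordinal lti = @Ordinal 3 1 isT); [exact: PY|exact/val_inj].
- by rewrite (_ : Ordinal lti = @Ordinal 3 2 isT); [exact: PZ|exact/val_inj].
Qed.

Lemma gen_rec (W : lmodType k) (w : W) (LX LY LZ : W -> W) :
  linear LX -> linear LY -> linear LZ -> exists E : F -> W,
  [/\ linear E, E 1 = w, forall p, E (X k * p) = LX (E p),
      forall p, E (Y k * p) = LY (E p) & forall p, E (Z k * p) = LZ (E p)].
Proof.
move=> linX linY linZ.
pose L (i : 'I_3) := match val i with 0%N => LX | 1%N => LY | _ => LZ end.
have linL i : linear (L i) by case: i => [[|[|i]] ?].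
have [E [linE E1 EL]] := free_rec w linL.
by exists E; split=> // p; exact: EL.
Qed.

Lemma to_alg_linear : linear (@to_alg k).
Proof. by move=> c p q; rewrite to_algD -alg_scaleE. Qed.

Lemma to_alg_monoid_morphism : monoid_morphism (@to_alg k).
Proof. by split=> [//|p q]; exact: esym (alg_mulE p q). Qed.

HB.instance Definition _ := GRing.isLinear.Build k F (alg k) *:%R (@to_alg k) to_alg_linear.
HB.instance Definition _ := GRing.isMonoidMorphism.Build F (alg k) (@to_alg k)
  to_alg_monoid_morphism.

Definition alg_proj : {lrmorphism F -> alg k} := @to_alg k.

Lemma proj_yx : alg_proj (X k * X k + Y k * X k) = 0.
Proof. 
rewrite -(rmorph0 alg_proj); apply/to_alg_eq; rewrite subr0; exact: rel_yx.
Qed.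

Lemma proj_xz : alg_proj (X k * Z k) = 0.
Proof. 
rewrite -(rmorph0 alg_proj); apply/to_alg_eq; rewrite subr0; exact: rel_xz.
Qed.

Lemma proj_zy : alg_proj (Z k * Y k) = 0.
Proof. 
rewrite -(rmorph0 alg_proj); apply/to_alg_eq; rewrite subr0; exact: rel_zy.
Qed.

Lemma proj_ker_ind (P : F -> Prop) :
  P (X k * X k + Y k * X k) -> P (X k * Z k) -> P (Z k * Y k) -> P 0 ->
  (forall p q, P p -> P q -> P (p + q)) -> (forall p q, P q -> P (p * q)) ->
  (forall p q, P p -> P (p * q)) -> forall p, alg_proj p = 0 -> P p.
Proof.
move=> Pyx Pxz Pzy P0 PD Pl Pr p; rewrite -(rmorph0 alg_proj) => /to_alg_eq.
rewrite subr0; elim=> {p} [||||p q _ Pp _ Pq|p q _ Pq|p q _ Pp].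
- exact: Pyx.
- exact: Pxz.
- exact: Pzy.
- exact: P0.
- exact: PD Pp Pq.
- exact: Pl Pq.
- exact: Pr Pp.
Qed.

End Instance.

(** The section of the projection is [repr], passed implicitly through [to_alg_repr]. *)
Local Notation on_alg h k := (h k _ _ _ _ _ (@free_scaleAr _ k) (@gen_ind k)
  (@gen_rec k) _ _ (@to_alg_repr k) (@proj_yx k) (@proj_xz k) (@proj_zy k)
  (@proj_ker_ind k)).


Theorem propositionA3 (k : fieldType) (char0 : [pchar k] =i pred0) :
  [/\ bracket_eq (@A2 k) A1 A2,
      forall m, (0 < m)%N -> bracket_eq (@A2 k) (B1 m) 0,
      forall m, (0 < m)%N -> bracket_eq (@A2 k) (C1 m) 0,
      forall m j, (0 < j < m)%N -> bracket_eq (@A2 k) (D1 m j) 0 &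
      forall q (r s : nat -> nat), (0 < q)%N -> positive r -> positive s ->
        [/\ bracket_eq (@A2 k) (E1 q r s) 0,
            bracket_eq (@A2 k) (F1 q r s) 0,
            bracket_eq (@A2 k) (G1 q r s) 0 &
            bracket_eq (@A2 k) (H1 q r s) 0]]
  /\
  forall p (n m : nat -> nat), (0 < p)%N -> positive n -> positive m ->
  let B : cochain2 k := B2 (seg n 2 p) (seg m 1 p) in
  [/\ bracket_eq B A1
        (- (((\sum_(2 <= i < p.+1) n i)%N%:R + p%:R - 2%:R) *: B)),
      forall l, (0 < l)%N ->
        bracket_eq B (B1 l)
          (- \sum_(2 <= i < p.+1)
               (n i)%:R *: B2 (seg n 2 i.-1 ++ [:: (n i + l)%N] ++ seg n i.+1 p)
                              (seg m 1 p)),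
      forall l, (0 < l)%N ->
        bracket_eq B (C1 l)
          (- \sum_(1 <= i < p.+1) \sum_(1 <= j < m i)
               B2 (seg n 2 i ++ [:: l.-1] ++ seg n i.+1 p)
                  (seg m 1 i.-1 ++ [:: j; (m i - j)%N] ++ seg m i.+1 p)),
      forall l j, (0 < j < l)%N -> bracket_eq B (D1 l j) 0 &
      forall q (r s : nat -> nat), (0 < q)%N -> positive r -> positive s ->
      [/\ bracket_eq B (E1 q r s) 0,
          bracket_eq B (F1 q r s)
            (- \sum_(2 <= i < p.+1) \sum_(0 <= j < n i)
                 B2 (seg n 2 i.-1 ++ [:: (r 1 + j)%N] ++ seg r 2 q
                       ++ [:: (r q.+1 + n i - j - 2)%N] ++ seg n i.+1 p)
                    (seg m 1 i.-1 ++ seg s 1 q ++ seg m i p)),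
          bracket_eq B (G1 q r s)
            (\sum_(1 <= i < p.+1) \sum_(1 <= j < m i)
               B2 (seg n 2 i ++ seg r 1 q ++ [:: (r q.+1).-1] ++ seg n i.+1 p)
                  (seg m 1 i.-1 ++ [:: j] ++ seg s 1 q ++ [:: (m i - j)%N]
                     ++ seg m i.+1 p)),
          q = 1%N ->
            bracket_eq B (H1 q r s)
              (- \sum_(1 <= i < p.+1)
                   (m i)%:R *: B2 (seg n 2 p)
                                  (seg m 1 i.-1 ++ [:: (s 1 + m i - 1)%N]
                                     ++ seg m i.+1 p)) &
          (2 <= q)%N ->
            bracket_eq B (H1 q r s)
              (- \sum_(1 <= i < p.+1) \sum_(0 <= j < m i)
                   B2 (seg n 2 i ++ seg r 2 q ++ seg n i.+1 p)
                      (seg m 1 i.-1 ++ [:: (j + s 1)%N] ++ seg s 2 q.-1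
                         ++ [:: (s q + m i - j - 1)%N] ++ seg m i.+1 p))]].
Proof.
split.
  split.
  - exact: (on_alg (@bracket_x_A1) k).
  - by case=> // l _; exact: (on_alg (@bracket_x_B1) k l).
  - by case=> // l _; exact: (on_alg (@bracket_x_C1) k l).
  - by move=> l j jl; exact: (on_alg (@bracket_x_D1) k jl).
  - move=> q r s q0 r0 s0; split.
    + exact: (on_alg (@hh_x_E) k q0 r0 s0).
    + exact: (on_alg (@hh_x_F) k q0 r0 s0).
    + exact: (on_alg (@hh_x_G) k q0 r0 s0).
    + exact: (on_alg (@hh_x_H) k r q0 s0).
move=> p n m p0 n0 m0; split.
- exact: (on_alg (@hh_word_A) k p0 n0 m0).
- by case=> // l _; exact: (on_alg (@hh_word_B) k p0 n0 m0 l).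
- by case=> // l _; exact: (on_alg (@hh_word_C) k p0 n0 m0 l).
- by move=> l j jl; exact: (on_alg (@hh_word_D) k p0 n0 m0 jl).
- move=> q r s q0 r0 s0; split.
  + exact: (on_alg (@hh_word_E) k q0 r0 s0 p0 n0 m0).
  + exact: (on_alg (@hh_word_F) k q0 r0 s0 p0 n0 m0).
  + exact: (on_alg (@hh_word_G) k q0 r0 s0 p0 n0 m0).
  + by move=> q1; exact: (on_alg (@hh_word_H1) k r q0 s0 p0 n0 m0 q1).
  + by move=> q1; exact: (on_alg (@hh_word_H2) k q0 r0 s0 p0 n0 m0 q1).
Qed.
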